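(* Let $\mu\in(0,\frac12)$, let $p_1<p_2$ be real numbers, and let $u_0$ be a tempered distribution on $\mathbb{R}$ satisfying Condition $(C_{[p_1,p_2],\mu})$. Let $u$ be the solution of the free Schrödinger equation with initial datum $u_0$. Fix $\varepsilon\in(0,\frac12)$, let $\delta\in(\frac12,1)$ satisfy $\delta>\frac12+\varepsilon$ and $\delta\ge\frac{\mu+1}{2}$, and put $\gamma:=2\delta-1$. Define $$(\sigma_1,\dots,\sigma_9):=\left(\tfrac12,\,1,\,1,\,2,\,\delta,\,\delta,\,\tfrac32,\,\delta,\,\delta\right),$$ $$(\varsigma_1,\dots,\varsigma_9):=\left(1-\mu,\,2-\mu,\,1-\mu,\,4-\mu,\,1+\gamma-\mu,\,\gamma-\mu,\,3-\mu,\,2-\mu,\,1-\mu\right).$$ Then there exist constants $C_0(u_0),\dots,C_9(u_0)\ge0$, depending only on $u_0$ and $\delta$, such that for all $(t,x)\in(0,+\infty)\times\mathbb{R}$ with $2p_1+2t^{-\varepsilon}\le\frac{x}{t}<2p_2$ and $t>(p_2-p_1)^{-1/\varepsilon}$, $$|u(t,x)|\le C_0(u_0)\,t^{-\mu+\varepsilon\mu}+\sum_{k=1}^9 C_k(u_0)\,t^{-\sigma_k+\varepsilon\varsigma_k},$$ where $\max_{1\le k\le9}\{-\sigma_k+\varepsilon\varsigma_k\}<-\mu+\varepsilon\mu$. Moreover the decay rate $t^{-\mu+\varepsilon\mu}$ is optimal, in the sense that it is attained on the left boundary of the region: there exist $c>0$ and $T>0$ such that $|u(t,x)|\ge c\,t^{-\mu+\varepsilon\mu}$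 for all $t\ge T$ and $x=2p_1t+2t^{1-\varepsilon}$.
   Context: Fourier transform: $\mathcal{F}v(p)=\int_{\mathbb{R}}v(x)e^{-ixp}\,dx$, extended to tempered distributions. Condition $(C_{[p_1,p_2],\mu})$: $\mathcal{F}u_0$ is a function vanishing on $\mathbb{R}\setminus[p_1,p_2]$, and $\mathcal{F}u_0(p)=(p-p_1)^{\mu-1}\tilde u(p)$ for $p\in(p_1,p_2)$, where $\tilde u\in\mathcal{C}^1([p_1,p_2],\mathbb{C})$, $\tilde u(p_1)\ne0$ and $\tilde u(p_2)=0$ (i.e. $\mathcal{F}u_0(p_2)=0$). The solution of $[i\partial_t+\partial_x^2]u=0$, $u(0,\cdot)=u_0$, is $u(t)=\mathcal{F}^{-1}(e^{-itp^2}\mathcal{F}u_0)$, that is, for $t>0$, $x\in\mathbb{R}$, $$u(t,x)=\frac1{2\pi}\int_{p_1}^{p_2}\mathcal{F}u_0(p)\,e^{-itp^2+ixp}\,dp .$$ *)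

(* Defs.v *)
From Stdlib Require Import Reals RList List.
From Coquelicot Require Import Coquelicot.
Open Scope R_scope.

(** [cis theta] is exp(i theta). *)
Definition cis (theta : R) : C := (cos theta, sin theta).

Definition CDerive_n (phi : R -> C) (n : nat) (x : R) : C :=
  (Derive_n (fun y => Re (phi y)) n x, Derive_n (fun y => Im (phi y)) n x).

Definition Csmooth (phi : R -> C) : Prop :=
  forall (n : nat) (x : R),
    ex_derive_n (fun y => Re (phi y)) n x /\
    ex_derive_n (fun y => Im (phi y)) n x.

Definition schwartz (phi : R -> C) : Prop :=
  Csmooth phi /\
  forall m n : nat, exists B : R,
    forall x : R, Rabs x ^ m * Cmod (CDerive_n phi n x) <= B.

Definition schwartz_cv (phis : nat -> R -> C) (phi : R -> C) : Prop :=
  forall (m n : nat) (e : posreal),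
    eventually (fun k => forall x : R,
      Rabs x ^ m * Cmod (CDerive_n (phis k) n x - CDerive_n phi n x)%C <= e).

(** A tempered distribution is a continuous linear form on the (metrizable)
    Schwartz space.  It is carried by a total functional on [R -> C], of which
    only the values at Schwartz functions are meaningful. *)
Record tempered (T : (R -> C) -> C) : Prop := {
  tempered_linear : forall (a : C) (phi psi : R -> C),
    schwartz phi -> schwartz psi ->
    T (fun x => a * phi x + psi x)%C = (a * T phi + T psi)%C;
  tempered_continuous : forall (phis : nat -> R -> C) (phi : R -> C),
    (forall k, schwartz (phis k)) -> schwartz phi -> schwartz_cv phis phi ->
    filterlim (fun k => T (phis k)) eventually (locally (T phi))
}.

Definition Fourier (phi : R -> C) (p : R) : C :=
  RInt_gen (V := C_R_CompleteNormedModule)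
    (fun x => phi x * cis (- (x * p)))%C
    (Rbar_locally m_infty) (Rbar_locally p_infty).

(** The transpose of [Fourier]; it maps tempered distributions to tempered
    distributions since [Fourier] maps Schwartz functions to such. *)
Definition Fourier_dist (T : (R -> C) -> C) : (R -> C) -> C :=
  fun phi => T (Fourier phi).

(** The distribution [T] is the function [f], which vanishes outside [[a, b]]:
    <T, phi> is the integral of [f phi] over R, hence over [(a, b)].  The
    integral is improper at [a] and [b], where [f] may be unbounded. *)
Record is_function_on (a b : R) (T : (R -> C) -> C) (f : R -> C) : Prop := {
  function_vanishes : forall p : R, ~ (a <= p <= b) -> f p = RtoC 0;
  function_pairing : forall phi : R -> C, schwartz phi ->
    is_RInt_gen (V := C_R_NormedModule) (fun p => f p * phi p)%C
      (at_right a) (at_left b) (T phi)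
}.

(** C^1 on the closed interval, with one-sided derivatives at the endpoints. *)
Definition C1_segment (a b : R) (v : R -> C) : Prop :=
  exists dv : R -> C,
    (forall p : R, a <= p <= b ->
       filterdiff (U := R_NormedModule) (V := C_R_NormedModule) v
         (within (fun q => a <= q <= b) (locally p))
         (fun h : R => (RtoC h * dv p)%C)) /\
    continuous_on (T := R_UniformSpace) (U := C_UniformSpace)
      (fun q => a <= q <= b) dv.

(** [Fu0] is the function representing the Fourier transform of [u0]; its
    values at the two endpoints are irrelevant. *)
Definition Condition_C (p1 p2 mu : R) (u0 : (R -> C) -> C) (Fu0 : R -> C)
  : Prop :=
  is_function_on p1 p2 (Fourier_dist u0) Fu0 /\
  exists util : R -> C,
    C1_segment p1 p2 util /\
    util p1 <> RtoC 0 /\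
    util p2 = RtoC 0 /\
    forall p : R, p1 < p < p2 ->
      Fu0 p = (RtoC (Rpower (p - p1) (mu - 1)) * util p)%C.

(** The solution F^{-1}(exp(-itp^2) F u0) of (i d_t + d_x^2) u = 0, when F u0
    is the function [Fu0] vanishing outside [[p1, p2]]. *)
Definition free_solution (p1 p2 : R) (Fu0 : R -> C) (t x : R) : C :=
  (RtoC (/ (2 * PI)) *
   RInt_gen (V := C_R_CompleteNormedModule)
     (fun p => Fu0 p * cis (- (t * p ^ 2) + x * p))%C
     (at_right p1) (at_left p2))%C.

(** The exponents are indexed by [1 <= k <= 9]; the default value of [nth] is
    never used in that range. *)
Definition exponent_sigma (delta : R) (k : nat) : R :=
  nth (k - 1)
    (1 / 2 :: 1 :: 1 :: 2 :: delta :: delta :: 3 / 2 :: delta :: delta :: nil) 0.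

Definition exponent_varsigma (mu delta : R) (k : nat) : R :=
  let gamma := 2 * delta - 1 in
  nth (k - 1)
    (1 - mu :: 2 - mu :: 1 - mu :: 4 - mu :: 1 + gamma - mu :: gamma - mu
     :: 3 - mu :: 2 - mu :: 1 - mu :: nil) 0.

(* Main.v *)
Require Import Defs.
From Stdlib Require Import Reals RList List Lra Lia.
From Coquelicot Require Import Coquelicot.
Open Scope R_scope.

(** With [d = x / (2t) - p1] and [p0 = p1 + d] the stationary point of the phase,
    the integral over [p1, p2] is cut at [p1 + h] and [p1 + d / 2], where
    [h = A / (t d)].  The singularity contributes [h^mu / mu] near [p1].  On each
    of the other pieces the amplitude is integrated by parts against a primitive
    of the oscillating factor, which is [O(1 / (t d))] away from [p0] and
    [O(t^(-1/2))] across it.  All this is [O((t d)^(-mu))] as soon as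
    [t d^2 >= 1], and [t d >= t^(1 - eps)] gives the rate; so [C_1, ..., C_9] can
    be taken to be 0, and for [t < 1] the trivial bound is enough.

    For the lower bound [d = t^(-eps)] and [A] is a large constant: on
    [p1, p1 + h] the integrand is close to [v(p1) s^(mu-1) exp(2 i t d s)] with
    [s = p - p1], whose integral has modulus at least [c (t d)^(-mu)] uniformly
    in [A], whereas the remaining pieces are
    [O(A^(mu-1) + (t d^2)^(mu-1/2)) (t d)^(-mu)]. *)

(** * Calculus of complex-valued functions of a real variable, reduced to real and imaginary
    parts *)

Local Notation CR := C_R_CompleteNormedModule.

Lemma norm_CR (z : C) : norm (V := CR) z = Cmod z.
Proof.
  unfold norm; simpl; unfold prod_norm, Cmod; f_equal.
  unfold norm; simpl; unfold abs; simpl.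
  now rewrite !Rmult_1_r, <- !Rabs_mult, !(Rabs_right (_ * _))
    by (apply Rle_ge; apply Rle_0_sqr).
Qed.

Lemma continuous_pair_CR (f g : R -> R) (x : R) :
  continuous f x -> continuous g x ->
  continuous (U := CR) (fun y => (f y, g y)) x.
Proof.
  intros Hf Hg.
  apply (continuous_comp_2 (W := R_UniformSpace) (V := R_UniformSpace)
    (X := CR) f g (fun a b => (a, b)) x Hf Hg).
  apply (continuous_ext (fun z : R * R => z)).
  - now intros [a b].
  - apply (continuous_id (U := CR)).
Qed.

Lemma continuous_Re_CR (f : R -> C) (x : R) :
  continuous (U := CR) f x -> continuous (fun y => Re (f y)) x.
Proof.
  intros Hf; apply (continuous_comp (V := CR) f (fun z : R * R => fst z) x Hf).
  destruct (f x); apply (continuous_fst (U := R_UniformSpace) (V := R_UniformSpace)).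
Qed.

Lemma continuous_Im_CR (f : R -> C) (x : R) :
  continuous (U := CR) f x -> continuous (fun y => Im (f y)) x.
Proof.
  intros Hf; apply (continuous_comp (V := CR) f (fun z : R * R => snd z) x Hf).
  destruct (f x); apply (continuous_snd (U := R_UniformSpace) (V := R_UniformSpace)).
Qed.

Lemma continuous_Cmult (f g : R -> C) (x : R) :
  continuous (U := CR) f x -> continuous (U := CR) g x ->
  continuous (U := CR) (fun y => f y * g y)%C x.
Proof.
  intros Hf Hg.
  apply continuous_pair_CR.
  - apply (continuous_minus (V := R_NormedModule));
      apply (continuous_mult (K := R_AbsRing));
      try apply continuous_Re_CR; try apply continuous_Im_CR; assumption.
  - apply (continuous_plus (V := R_NormedModule));
      apply (continuous_mult (K := R_AbsRing));
      try apply continuous_Re_CR; try apply continuous_Im_CR; assumption.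
Qed.

Lemma is_derive_pair_CR (f g : R -> R) (x df dg : R) :
  is_derive f x df -> is_derive g x dg ->
  is_derive (V := CR) (fun y => (f y, g y)) x (df, dg).
Proof.
  intros Hf Hg.
  apply (filterdiff_ext_lin (V := CR) _ (fun h : R => (scal h df, scal h dg)));
    [|now intros].
  apply (filterdiff_comp'_2 (W := CR) f g (fun a b => (a, b)) x
    (fun h => scal h df) (fun h => scal h dg) (fun a b => (a, b)) Hf Hg).
  apply (filterdiff_ext (V := CR) (fun z : R * R => z)).
  - now intros [a b].
  - apply (filterdiff_ext_lin (V := CR) _ (fun z : R * R => z)); [|now intros [a b]].
    apply (filterdiff_id (V := CR)).
Qed.

Lemma is_derive_Re_CR (f : R -> C) (x : R) (l : C) :
  is_derive (V := CR) f x l -> is_derive (fun y => Re (f y)) x (Re l).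
Proof.
  intros Hf.
  apply (filterdiff_comp' (V := CR) (W := R_NormedModule) f (fun z : R * R => fst z) x
    (fun h => scal h l) (fun z : R * R => fst z) Hf).
  apply filterdiff_linear, (is_linear_fst (U := R_NormedModule) (V := R_NormedModule)).
Qed.

Lemma is_derive_Im_CR (f : R -> C) (x : R) (l : C) :
  is_derive (V := CR) f x l -> is_derive (fun y => Im (f y)) x (Im l).
Proof.
  intros Hf.
  apply (filterdiff_comp' (V := CR) (W := R_NormedModule) f (fun z : R * R => snd z) x
    (fun h => scal h l) (fun z : R * R => snd z) Hf).
  apply filterdiff_linear, (is_linear_snd (U := R_NormedModule) (V := R_NormedModule)).
Qed.

Lemma is_derive_Cmult (f g : R -> C) (x : R) (df dg : C) :
  is_derive (V := CR) f x df -> is_derive (V := CR) g x dg ->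
  is_derive (V := CR) (fun y => f y * g y)%C x (df * g x + f x * dg)%C.
Proof.
  intros Hf Hg.
  replace (df * g x + f x * dg)%C with
    ((Re df * Re (g x) + Re (f x) * Re dg) - (Im df * Im (g x) + Im (f x) * Im dg),
     (Re df * Im (g x) + Re (f x) * Im dg) + (Im df * Re (g x) + Im (f x) * Re dg))
    by (apply injective_projections; unfold Re, Im; simpl; ring).
  apply is_derive_pair_CR.
  - apply (is_derive_minus (V := R_NormedModule));
      apply Derive.is_derive_mult;
      try apply is_derive_Re_CR; try apply is_derive_Im_CR; assumption.
  - apply (is_derive_plus (V := R_NormedModule));
      apply Derive.is_derive_mult;
      try apply is_derive_Re_CR; try apply is_derive_Im_CR; assumption.
Qed.

Lemma is_RInt_Re_CR (f : R -> C) (a b : R) (l : C) :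
  is_RInt (V := CR) f a b l -> is_RInt (fun y => Re (f y)) a b (Re l).
Proof. apply (is_RInt_fct_extend_fst (U := R_NormedModule) (V := R_NormedModule)). Qed.

Lemma is_RInt_Im_CR (f : R -> C) (a b : R) (l : C) :
  is_RInt (V := CR) f a b l -> is_RInt (fun y => Im (f y)) a b (Im l).
Proof. apply (is_RInt_fct_extend_snd (U := R_NormedModule) (V := R_NormedModule)). Qed.

Lemma is_RInt_Cmult_l (z : C) (f : R -> C) (a b : R) (l : C) :
  is_RInt (V := CR) f a b l -> is_RInt (V := CR) (fun y => z * f y)%C a b (z * l)%C.
Proof.
  intros Hf.
  assert (Hr := is_RInt_Re_CR _ _ _ _ Hf); assert (Hi := is_RInt_Im_CR _ _ _ _ Hf).
  apply (is_RInt_fct_extend_pair (U := R_NormedModule) (V := R_NormedModule)).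
  - apply (is_RInt_minus (V := R_NormedModule));
      apply (is_RInt_scal (V := R_NormedModule)); assumption.
  - apply (is_RInt_plus (V := R_NormedModule));
      apply (is_RInt_scal (V := R_NormedModule)); assumption.
Qed.

(** * Bounds for the modulus of an integral, and integration by parts *)

Lemma Cmod_RInt_le (f : R -> C) (g : R -> R) (a b : R) (lf : C) (lg : R) :
  a <= b -> (forall x, a <= x <= b -> Cmod (f x) <= g x) ->
  is_RInt (V := CR) f a b lf -> is_RInt g a b lg -> Cmod lf <= lg.
Proof.
  intros Hab Hfg Hf Hg; rewrite <- norm_CR.
  apply (norm_RInt_le f g a b lf lg Hab); [|exact Hf|exact Hg].
  intros x Hx; generalize (Hfg x Hx); rewrite <- norm_CR; exact (fun h => h).
Qed.

(** Asking for an explicit primitive of the majorant turns each such bound into an evaluation at two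
    points; in the uses below the primitives are affine functions and combinations of powers of
    [p - p1]. *)
Lemma Cmod_RInt_le_primitive (f : R -> C) (Phi phi : R -> R) (a b : R) :
  a <= b ->
  (forall x, a <= x <= b -> continuous (U := CR) f x) ->
  (forall x, a <= x <= b -> is_derive Phi x (phi x)) ->
  (forall x, a <= x <= b -> continuous phi x) ->
  (forall x, a <= x <= b -> Cmod (f x) <= phi x) ->
  Cmod (RInt (V := CR) f a b) <= Phi b - Phi a.
Proof.
  intros Hab Hf HPhi Hphi Hle.
  apply (Cmod_RInt_le f phi a b); auto.
  - apply (RInt_correct (V := CR)), ex_RInt_continuous.
    rewrite Rmin_left, Rmax_right by assumption; exact Hf.
  - apply (is_RInt_derive (V := R_CompleteNormedModule));
      rewrite Rmin_left, Rmax_right by assumption; assumption.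
Qed.

Lemma Cmod_RInt_Chasles (f : R -> C) (a b c : R) (A B : R) :
  ex_RInt (V := CR) f a b -> ex_RInt (V := CR) f b c ->
  Cmod (RInt (V := CR) f a b) <= A -> Cmod (RInt (V := CR) f b c) <= B ->
  Cmod (RInt (V := CR) f a c) <= A + B.
Proof.
  intros H1 H2 HA HB.
  rewrite <- (RInt_Chasles (V := CR) f a b c H1 H2).
  eapply Rle_trans; [apply Cmod_triangle|]; lra.
Qed.

(** Integration by parts with the primitive [G] of [g] that vanishes at [a]: only the boundary term
    at [b] survives, and [B] bounds [G] in it and in the integral of [dpsi * G]. The variation of
    [psi] enters through the primitive [Phi] of a majorant of its derivative. *)
Lemma Cmod_RInt_mult_le (psi dpsi g : R -> C) (Phi phi : R -> R) (a b B : R) :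
  a <= b ->
  (forall x, a <= x <= b -> is_derive (V := CR) psi x (dpsi x)) ->
  (forall x, a <= x <= b -> continuous (U := CR) dpsi x) ->
  (forall x, continuous (U := CR) g x) ->
  (forall y, a <= y <= b -> Cmod (RInt (V := CR) g a y) <= B) ->
  (forall x, a <= x <= b -> is_derive Phi x (phi x)) ->
  (forall x, a <= x <= b -> continuous phi x) ->
  (forall x, a <= x <= b -> Cmod (dpsi x) <= phi x) ->
  Cmod (RInt (V := CR) (fun x => psi x * g x)%C a b)
    <= B * (Cmod (psi b) + (Phi b - Phi a)).
Proof.
  intros Hab Hpsi Hdpsi Hg HB HPhi Hphi Hle.
  set (G := fun y => RInt (V := CR) g a y).
  assert (Hex : forall u v, ex_RInt (V := CR) g u v)
    by (intros; apply ex_RInt_continuous; auto).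
  assert (HG : forall y, is_derive (V := CR) G y (g y)).
  { intros y; apply (is_derive_RInt (V := CR) g G a y); auto.
    apply filter_forall; intros z; apply (RInt_correct (V := CR)), Hex. }
  assert (HGc : forall y, continuous (U := CR) G y)
    by (intros y; apply (ex_derive_continuous (V := CR)); eexists; apply HG).
  assert (Hpc : forall x, a <= x <= b -> continuous (U := CR) psi x)
    by (intros x Hx; apply (ex_derive_continuous (V := CR)); eexists; eauto).
  assert (HGa : G a = RtoC 0) by (unfold G; apply (RInt_point (V := CR))).
  assert (H1 : is_RInt (V := CR) (fun x => dpsi x * G x + psi x * g x)%C a b
    (psi b * G b)%C).
  { replace (psi b * G b)%C with (minus (G := CR) (psi b * G b)%C (psi a * G a)%C).
    - apply (is_RInt_derive (V := CR) (fun x => psi x * G x)%C);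
        rewrite Rmin_left, Rmax_right by assumption; intros x Hx.
      + apply is_derive_Cmult; auto.
      + apply (continuous_plus (V := CR)); apply continuous_Cmult; auto.
    - rewrite HGa; change (psi b * G b - psi a * RtoC 0 = psi b * G b)%C; ring. }
  assert (Hc2 : forall x, a <= x <= b -> continuous (U := CR) (fun x => dpsi x * G x)%C x)
    by (intros; apply continuous_Cmult; auto).
  assert (H2 : is_RInt (V := CR) (fun x => dpsi x * G x)%C a b
    (RInt (V := CR) (fun x => dpsi x * G x)%C a b)).
  { apply (RInt_correct (V := CR)), ex_RInt_continuous.
    rewrite Rmin_left, Rmax_right by assumption; exact Hc2. }
  assert (Hval : Cmod (RInt (V := CR) (fun x => dpsi x * G x)%C a b) <= B * Phi b - B * Phi a).
  { apply (Cmod_RInt_le_primitive _ (fun x => B * Phi x) (fun x => B * phi x)); auto.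
    - intros x Hx; apply (is_derive_scal Phi); auto.
    - intros x Hx; apply (continuous_scal_r (V := R_NormedModule)); auto.
    - intros x Hx; rewrite Cmod_mult, Rmult_comm.
      apply Rmult_le_compat; try apply Cmod_ge_0; [apply HB|apply Hle]; assumption. }
  rewrite (is_RInt_unique (V := CR) _ a b
    (minus (G := CR) (psi b * G b)%C (RInt (V := CR) (fun x => dpsi x * G x)%C a b))).
  - eapply Rle_trans; [apply (Cmod_triangle (psi b * G b)%C)|].
    change (opp (G := CR)) with Copp; rewrite Cmod_opp, Cmod_mult.
    assert (Cmod (psi b) * Cmod (G b) <= Cmod (psi b) * B)
      by (apply Rmult_le_compat_l; [apply Cmod_ge_0|apply HB; lra]).
    lra.
  - eapply (is_RInt_ext (V := CR));
      [|apply (is_RInt_minus (V := CR) _ _ _ _ _ _ H1 H2)].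
    intros x _; cbv beta.
    change (dpsi x * G x + psi x * g x - dpsi x * G x = psi x * g x)%C; ring.
Qed.

(** * Oscillatory integrals with the quadratic phase, away from the stationary point and across
    it *)

Definition osc (t x p : R) : C := cis (- (t * p ^ 2) + x * p).

Lemma Cmod_cis (y : R) : Cmod (cis y) = 1.
Proof.
  unfold Cmod, cis; simpl; rewrite !Rmult_1_r, Rplus_comm.
  change (sqrt (Rsqr (sin y) + Rsqr (cos y)) = 1).
  now rewrite sin2_cos2, sqrt_1.
Qed.

Lemma cis_plus (y z : R) : cis (y + z) = (cis y * cis z)%C.
Proof.
  apply injective_projections; simpl; [apply cos_plus|rewrite sin_plus; ring].
Qed.

Lemma continuous_osc (t x p : R) : continuous (U := CR) (osc t x) p.
Proof.
  apply continuous_pair_CR; apply (ex_derive_continuous (V := R_NormedModule));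
    auto_derive; exact I.
Qed.

Lemma ex_RInt_osc (t x a b : R) : ex_RInt (V := CR) (osc t x) a b.
Proof. apply ex_RInt_continuous; intros; apply continuous_osc. Qed.

(* [osc] is the derivative of a bounded function times the monotone factor
   [1 / theta'], where [theta' = x - 2 t p]. *)
Lemma osc_nonstationary (t x a b lambda : R) :
  0 < t -> 0 < lambda -> a <= b ->
  lambda <= x - 2 * t * b \/ x - 2 * t * a <= - lambda ->
  Cmod (RInt (V := CR) (osc t x) a b) <= 4 / lambda.
Proof.
  intros Ht Hl Hab Hcase.
  assert (Hne : forall p, a <= p <= b ->
    lambda <= x - 2 * t * p \/ x - 2 * t * p <= - lambda).
  { intros p Hp; destruct Hcase; [left|right]; nra. }
  assert (Hinv : forall p, a <= p <= b -> Rabs (/ (x - 2 * t * p)) <= / lambda).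
  { intros p Hp; rewrite Rabs_inv; apply Rinv_le_contravar; [assumption|].
    destruct (Hne p Hp); [rewrite Rabs_right|rewrite Rabs_left]; lra. }
  set (g := fun p => (RtoC (x - 2 * t * p) * osc t x p)%C).
  assert (Hgc : forall p, continuous (U := CR) g p).
  { intros p; apply continuous_Cmult; [|apply continuous_osc].
    apply continuous_pair_CR; apply (ex_derive_continuous (V := R_NormedModule));
      auto_derive; exact I. }
  rewrite (RInt_ext (V := CR) _ (fun p => RtoC (/ (x - 2 * t * p)) * g p)%C).
  2:{ rewrite Rmin_left, Rmax_right by assumption; intros p Hp; unfold g.
      assert (x - 2 * t * p <> 0) by (destruct (Hne p); lra).
      rewrite Cmult_assoc, <- RtoC_mult, Rinv_l by assumption.
      symmetry; apply Cmult_1_l. }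
  eapply Rle_trans.
  - apply (Cmod_RInt_mult_le (fun p => RtoC (/ (x - 2 * t * p)))
      (fun p => RtoC (2 * t / (x - 2 * t * p) ^ 2)) g
      (fun p => / (x - 2 * t * p)) (fun p => 2 * t / (x - 2 * t * p) ^ 2) a b 2);
      try assumption.
    + intros p Hp; apply is_derive_pair_CR; auto_derive; try exact I.
      * destruct (Hne p Hp); lra.
      * field; destruct (Hne p Hp); lra.
      * reflexivity.
    + intros p Hp; apply continuous_pair_CR;
        apply (ex_derive_continuous (V := R_NormedModule)); auto_derive; try exact I.
      destruct (Hne p Hp); nra.
    + intros y Hy.
      (* This is -i exp(i theta), a primitive of [g] of modulus 1; the constant 2 comes from its two
         endpoint values. *)
      set (F := fun p => (sin (- (t * p ^ 2) + x * p), - cos (- (t * p ^ 2) + x * p)) : C).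
      assert (HF : forall p, Cmod (F p) = 1).
      { intros p; unfold Cmod, F; simpl; rewrite !Rmult_1_r, Rmult_opp_opp.
        set (u := - _ + _); change (sqrt (Rsqr (sin u) + Rsqr (cos u)) = 1).
        now rewrite sin2_cos2, sqrt_1. }
      rewrite (is_RInt_unique (V := CR) g a y (minus (G := CR) (F y) (F a))).
      * eapply Rle_trans; [apply (Cmod_triangle (F y))|].
        change (opp (G := CR)) with Copp; rewrite Cmod_opp, !HF; lra.
      * apply (is_RInt_derive (V := CR)); intros p _; [|apply Hgc].
        replace (g p) with
          (cos (- (t * p ^ 2) + x * p) * (x - 2 * t * p),
           sin (- (t * p ^ 2) + x * p) * (x - 2 * t * p))
          by (apply injective_projections; unfold g, osc; simpl; ring).
        apply is_derive_pair_CR; auto_derive; try exact I; simpl; ring.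
    + intros p Hp; auto_derive; [|field]; destruct (Hne p Hp); lra.
    + intros p Hp; apply (ex_derive_continuous (V := R_NormedModule)); auto_derive.
      destruct (Hne p Hp); nra.
    + intros p Hp; rewrite Cmod_R, Rabs_right; [apply Rle_refl|].
      assert (0 < (x - 2 * t * p) ^ 2) by (destruct (Hne p Hp); nra).
      apply Rle_ge, Rlt_le, Rdiv_lt_0_compat; lra.
  (* The function 1 / theta' increases. If theta' > 0, then |1 / theta'(b)| plus the increment is at
     most 2 / theta'(b); if theta' < 0, the sum telescopes to 1 / |theta'(a)|. *)
  - rewrite Cmod_R.
    assert (Ha := Hinv a (conj (Rle_refl a) Hab)).
    assert (Hb := Hinv b (conj Hab (Rle_refl b))).
    apply Rabs_le_between in Ha.
    assert (Hs : 4 / lambda = 4 * / lambda) by reflexivity.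
    destruct Hcase as [H|H].
    + assert (0 < / (x - 2 * t * a)) by (apply Rinv_0_lt_compat; nra).
      assert (Hb' := Rle_abs (/ (x - 2 * t * b))); lra.
    + assert (/ (x - 2 * t * b) < 0) by (apply Rinv_lt_0_compat; nra).
      rewrite Rabs_left by assumption; lra.
Qed.

(* The interval is cut at distance [kappa] from the stationary point [x / 2t];
   the three pieces may be empty. *)
Lemma osc_stationary (t x a b kappa : R) :
  0 < t -> 0 < kappa -> a <= b ->
  Cmod (RInt (V := CR) (osc t x) a b) <= 2 * kappa + 4 / (t * kappa).
Proof.
  intros Ht Hk Hab.
  assert (Hx : x = 2 * t * (x / (2 * t))) by (field; lra).
  set (q := x / (2 * t)) in *.
  set (c := Rmax a (Rmin b (q - kappa))); set (d := Rmax a (Rmin b (q + kappa))).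
  assert (Hcd : a <= c <= d /\ d <= b /\ d - c <= 2 * kappa /\
    (a < c -> c <= q - kappa) /\ (d < b -> q + kappa <= d)).
  { unfold c, d, Rmax, Rmin; repeat destruct Rle_dec; lra. }
  clearbody c d; destruct Hcd as (Hac & Hdb & Hlen & Hc & Hd).
  assert (Htk : 0 < t * kappa) by nra.
  (* At distance at least [kappa] from [q] the derivative of the phase is at least 2 t kappa in
     absolute value, so each outer piece costs 4 / (2 t kappa); the inner piece costs its length. *)
  assert (Hhalf : 4 / (2 * (t * kappa)) = 2 / (t * kappa)) by (field; lra).
  assert (Hpos : 0 < 2 / (t * kappa)) by (apply Rdiv_lt_0_compat; lra).
  assert (H1 : Cmod (RInt (V := CR) (osc t x) a c) <= 2 / (t * kappa)).
  { destruct (Rle_lt_dec c a) as [H|H].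
    - replace c with a by lra; rewrite (RInt_point (V := CR)).
      change (zero (G := CR)) with (RtoC 0); rewrite Cmod_0; lra.
    - rewrite <- Hhalf; apply osc_nonstationary; try lra.
      left; specialize (Hc H); nra. }
  assert (H3 : Cmod (RInt (V := CR) (osc t x) d b) <= 2 / (t * kappa)).
  { destruct (Rle_lt_dec b d) as [H|H].
    - replace d with b by lra; rewrite (RInt_point (V := CR)).
      change (zero (G := CR)) with (RtoC 0); rewrite Cmod_0; lra.
    - rewrite <- Hhalf; apply osc_nonstationary; try lra.
      right; specialize (Hd H); nra. }
  assert (H2 : Cmod (RInt (V := CR) (osc t x) c d) <= d - c).
  { apply (Cmod_RInt_le_primitive _ (fun p => p) (fun _ => 1)); try lra; intros.
    - apply continuous_osc.
    - apply (is_derive_id (K := R_AbsRing)).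
    - apply (continuous_const (V := R_UniformSpace)).
    - unfold osc; rewrite Cmod_cis; lra. }
  replace (2 * kappa + 4 / (t * kappa))
    with (2 / (t * kappa) + (2 * kappa + 2 / (t * kappa))) by (field; nra).
  apply (Cmod_RInt_Chasles _ a c b); try apply ex_RInt_osc; try assumption.
  apply (Cmod_RInt_Chasles _ c d b); try apply ex_RInt_osc; try assumption; lra.
Qed.

(** * Integrals that are improper at both endpoints *)

Lemma at_right_interval (a b : R) : a < b -> at_right a (fun u => a < u < b).
Proof.
  intros Hab; assert (Hp : 0 < b - a) by lra.
  exists (mkposreal _ Hp); intros y Hy Hay; split; [exact Hay|].
  unfold ball in Hy; simpl in Hy; unfold AbsRing_ball, abs, minus, plus, opp in Hy.
  simpl in Hy; apply Rabs_lt_between in Hy; lra.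
Qed.

Lemma at_left_interval (a b : R) : a < b -> at_left b (fun u => a < u < b).
Proof.
  intros Hab; assert (Hp : 0 < b - a) by lra.
  exists (mkposreal _ Hp); intros y Hy Hyb; split; [|exact Hyb].
  unfold ball in Hy; simpl in Hy; unfold AbsRing_ball, abs, minus, plus, opp in Hy.
  simpl in Hy; apply Rabs_lt_between in Hy; lra.
Qed.

(** Reduces estimates of the improper integral to compact subintervals, whose endpoints may be taken
    as close to [a] and [b] as an argument requires. *)
Lemma is_RInt_gen_approx (f : R -> C) (a b alpha beta : R) (l : C) (e : R) :
  a < alpha -> beta < b -> 0 < e ->
  is_RInt_gen (V := CR) f (at_right a) (at_left b) l ->
  exists u v, a < u < alpha /\ beta < v < b /\
    Cmod (RInt (V := CR) f u v - l)%C < e.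
Proof.
  intros Ha Hb He Hl.
  assert (Hloc : locally (T := CR) l (fun z => Cmod (z - l)%C < e)).
  { apply (locally_le_locally_norm (V := CR)); exists (mkposreal e He).
    intros z Hz; rewrite <- norm_CR; exact Hz. }
  specialize (Hl _ Hloc); unfold filtermapi in Hl.
  destruct Hl as [P Q HP HQ HPQ].
  assert (HP' : at_right a (fun u => P u /\ a < u < alpha)).
  { apply filter_and; [exact HP|].
    apply at_right_interval; assumption. }
  assert (HQ' : at_left b (fun v => Q v /\ beta < v < b)).
  { apply filter_and; [exact HQ|].
    apply at_left_interval; assumption. }
  destruct (filter_ex _ HP') as [u [Hu1 Hu2]], (filter_ex _ HQ') as [v [Hv1 Hv2]].
  exists u, v; split; [|split]; try assumption.
  destruct (HPQ u v Hu1 Hv1) as [y [Hy1 Hy2]]; simpl in Hy1.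
  now rewrite (is_RInt_unique (V := CR) _ _ _ _ Hy1).
Qed.

(** Cauchy criterion along the product filter: changing the endpoints alters the integral by at most
    the increments of [Phi], which are small because [Phi] has a limit at each end. *)
Lemma ex_RInt_gen_dominated (f : R -> C) (Phi phi : R -> R) (a b la lb : R) :
  a < b ->
  (forall x, a < x < b -> continuous (U := CR) f x) ->
  (forall x, a < x < b -> is_derive Phi x (phi x)) ->
  (forall x, a < x < b -> continuous phi x) ->
  (forall x, a < x < b -> Cmod (f x) <= phi x) ->
  filterlim Phi (at_right a) (locally la) ->
  filterlim Phi (at_left b) (locally lb) ->
  ex_RInt_gen (V := CR) f (at_right a) (at_left b).
Proof.
  intros Hab Hf HPhi Hphi Hle Hla Hlb.
  assert (Hex : forall u v, a < u < b -> a < v < b -> ex_RInt (V := CR) f u v).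
  { intros u v Hu Hv; apply ex_RInt_continuous; intros z Hz; apply Hf.
    revert Hz; unfold Rmin, Rmax; destruct Rle_dec; lra. }
  assert (Hle1 : forall u v, a < u -> u <= v -> v < b ->
    Cmod (RInt (V := CR) f u v) <= Rabs (Phi v - Phi u)).
  { intros u v Hu Huv Hv; eapply Rle_trans; [|apply Rle_abs].
    apply Cmod_RInt_le_primitive with phi; try assumption;
      intros; [apply Hf|apply HPhi|apply Hphi|apply Hle]; lra. }
  assert (Hle2 : forall u v, a < u < b -> a < v < b ->
    Cmod (RInt (V := CR) f u v) <= Rabs (Phi v - Phi u)).
  { intros u v Hu Hv; destruct (Rle_dec u v); [apply Hle1; lra|].
    rewrite <- (opp_RInt_swap (V := CR)) by (apply Hex; assumption).
    change (opp (G := CR)) with Copp; rewrite Cmod_opp, Rabs_minus_sym.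
    apply Hle1; lra. }
  set (F := fun uv : R * R => RInt (V := CR) f (fst uv) (snd uv)).
  assert (Hproper : ProperFilter (filter_prod (at_right a) (at_left b)))
    by (apply filter_prod_proper; apply _).
  destruct (proj1 (filterlim_locally_cauchy (U := CR)
    (F := filter_prod (at_right a) (at_left b)) F)) as [l Hl].
  - intros eps.
    (* At each end two values of [Phi] lie within eps/4 of the same limit, hence differ by less than
       eps/2; the two ends together give eps. *)
    assert (He : 0 < eps / 4) by (destruct eps; simpl; lra).
    assert (HA : at_right a (fun u => ball la (mkposreal _ He) (Phi u) /\ a < u < b)).
    { apply filter_and; [apply Hla, locally_ball|].
      apply at_right_interval; assumption. }
    assert (HB : at_left b (fun u => ball lb (mkposreal _ He) (Phi u) /\ a < u < b)).
    { apply filter_and; [apply Hlb, locally_ball|].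
      apply at_left_interval; assumption. }
    exists (fun uv => (ball la (mkposreal _ He) (Phi (fst uv)) /\ a < fst uv < b) /\
      (ball lb (mkposreal _ He) (Phi (snd uv)) /\ a < snd uv < b)).
    split; [exact (Filter_prod _ _ _ _ _ HA HB (fun x y Hx Hy => conj Hx Hy))|].
    intros [u v] [u' v'] [[Hu1 Hu2] [Hv1 Hv2]] [[Hu1' Hu2'] [Hv1' Hv2']]; simpl in *.
    apply (norm_compat1 (V := CR)); rewrite norm_CR.
    change (Cmod (F (u', v') - F (u, v))%C < eps).
    replace (F (u', v') - F (u, v))%C
      with (RInt (V := CR) f u' u + RInt (V := CR) f v v')%C.
    + eapply Rle_lt_trans; [apply Cmod_triangle|].
      assert (H1 := Hle2 u' u Hu2' Hu2); assert (H2 := Hle2 v v' Hv2 Hv2').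
      unfold ball in Hu1, Hv1, Hu1', Hv1'; simpl in Hu1, Hv1, Hu1', Hv1'.
      unfold AbsRing_ball, abs, minus, plus, opp in Hu1, Hv1, Hu1', Hv1'; simpl in Hu1, Hv1, Hu1', Hv1'.
      apply Rabs_lt_between in Hu1, Hv1, Hu1', Hv1'.
      assert (Rabs (Phi u - Phi u') < eps / 2) by (apply Rabs_lt_between; lra).
      assert (Rabs (Phi v' - Phi v) < eps / 2) by (apply Rabs_lt_between; lra).
      lra.
    + unfold F; simpl.
      rewrite <- (RInt_Chasles (V := CR) f u' u v'), <- (RInt_Chasles (V := CR) f u v v')
        by (apply Hex; assumption).
      change (@eq C (RInt (V := CR) f u' u + RInt (V := CR) f v v')
        (RInt (V := CR) f u' u + (RInt (V := CR) f u v + RInt (V := CR) f v v')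
          - RInt (V := CR) f u v))%C.
      ring.
  (* [RInt] is a total function, so its limit says something about integrals only once both
     endpoints are known to lie inside (a, b), where [f] is integrable. *)
  - exists l; intros P HP; specialize (Hl P HP).
    assert (HAB : filter_prod (at_right a) (at_left b)
      (fun uv => a < fst uv < b /\ a < snd uv < b)).
    { apply Filter_prod with (Q := fun u => a < u < b) (R := fun v => a < v < b).
      - now apply at_right_interval.
      - now apply at_left_interval.
      - intros; simpl; auto. }
    eapply (filter_imp (F := filter_prod (at_right a) (at_left b))); [|exact (filter_and (fun uv => P (F uv)) _ Hl HAB)]; intros [u v] [HF [Hu Hv]].
    exists (F (u, v)); split; [|exact HF].
    apply (RInt_correct (V := CR)), Hex; assumption.
Qed.

(** * Functions of class C^1 on a closed interval, as seen from its interior *)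

Lemma bounded_on_segment (f : R -> C) (a b : R) :
  a <= b ->
  continuous_on (T := R_UniformSpace) (U := C_UniformSpace) (fun q => a <= q <= b) f ->
  exists M, forall p, a <= p <= b -> Cmod (f p) <= M.
Proof.
  intros Hab Hf.
  (* Composition with the projection onto [a, b], which is 1-Lipschitz, extends [f] to a function
     with two-sided continuity at the endpoints as well. *)
  set (c := fun p => Rmax a (Rmin b p)).
  assert (Hc : forall p, a <= c p <= b)
    by (intros p; unfold c, Rmax, Rmin; repeat destruct Rle_dec; lra).
  assert (Hid : forall p, a <= p <= b -> c p = p)
    by (intros p Hp; unfold c, Rmax, Rmin; repeat destruct Rle_dec; lra).
  assert (Hlip : forall p q, Rabs (c p - c q) <= Rabs (p - q)).
  { intros p q; unfold c, Rmax, Rmin, Rabs;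
      repeat destruct Rle_dec; repeat destruct Rcase_abs; lra. }
  destruct (bounded_continuity (V := CR) (fun p => f (c p)) a b) as [M HM].
  - intros p _ P HP.
    destruct (Hf (c p) (Hc p) P HP) as [e He]; exists e.
    intros q Hq; apply He; [|apply Hc].
    eapply Rle_lt_trans; [apply Hlip|exact Hq].
  - exists M; intros p Hp; specialize (HM p Hp); rewrite norm_CR, Hid in HM by assumption.
    lra.
Qed.

(** The form in which the C^1 factor enters the estimates: on the open interval its derivative is
    two-sided, and a single constant bounds both the function and the derivative. *)
Record amplitude (p1 p2 : R) (v dv : R -> C) (M : R) : Prop := {
  amplitude_pos : 0 < M;
  amplitude_derive : forall p, p1 < p < p2 -> is_derive (V := CR) v p (dv p);
  amplitude_continuous : forall p, p1 < p < p2 -> continuous (U := CR) dv p;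
  amplitude_bound : forall p, p1 < p < p2 -> Cmod (v p) <= M;
  amplitude_derive_bound : forall p, p1 < p < p2 -> Cmod (dv p) <= M
}.

Lemma locally_le_within_open (a b p : R) :
  a < p < b -> filter_le (locally p) (within (fun q => a <= q <= b) (locally p)).
Proof.
  intros Hp P HP.
  assert (H : locally p (fun q => a < q /\ q < b)).
  { apply filter_and; [apply (open_gt a)|apply (open_lt b)]; lra. }
  unfold within in HP; generalize (filter_and (F := locally p) _ _ HP H).
  apply filter_imp; intros q [HPq Hq]; apply HPq; lra.
Qed.

(** The second conclusion, continuity at the singular endpoint, serves the lower bound, where [v] is
    frozen at [a]. *)
Lemma C1_segment_amplitude (a b : R) (v : R -> C) :
  a < b -> C1_segment a b v ->
  (exists dv M, amplitude a b v dv M) /\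
  (forall eta, 0 < eta -> exists h, 0 < h /\
     forall p, a < p < b -> p < a + h -> Cmod (v p - v a)%C <= eta).
Proof.
  intros Hab (dv & Hv & Hdv).
  assert (Hvc : continuous_on (T := R_UniformSpace) (U := C_UniformSpace)
    (fun q => a <= q <= b) v).
  { intros p Hp.
    apply (filterdiff_continuous_aux (U := R_NormedModule) (V := C_R_NormedModule)).
    - eexists; apply Hv, Hp.
    - intros P HP; apply filter_imp with (2 := HP); auto. }
  split.
  - destruct (bounded_on_segment v a b) as [M HM]; [lra|exact Hvc|].
    destruct (bounded_on_segment dv a b) as [M' HM']; [lra|exact Hdv|].
    (* Adding 1 makes the common bound strictly positive even when [v] and [dv] vanish. *)
    exists dv, (1 + Rmax 0 (Rmax M M')).
    assert (H0 := Rmax_l 0 (Rmax M M')); assert (H1 := Rmax_r 0 (Rmax M M')).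
    assert (H2 := Rmax_l M M'); assert (H3 := Rmax_r M M').
    constructor.
    + lra.
    + intros p Hp.
      apply (filterdiff_ext_lin (V := CR) _ (fun h : R => (RtoC h * dv p)%C)).
      * destruct (Hv p) as [Hlin Hd]; [lra|]; split; [exact Hlin|].
        intros x Hx e; apply (locally_le_within_open a b p Hp), Hd.
        intros P HP; specialize (Hx P HP); apply filter_imp with (2 := Hx); auto.
      * intros h; apply injective_projections; simpl; unfold scal; simpl;
          unfold mult; simpl; ring.
    + intros p Hp P HP; apply (locally_le_within_open a b p Hp), Hdv; [lra|exact HP].
    + intros p Hp; specialize (HM p); lra.
    + intros p Hp; specialize (HM' p); lra.
  - intros eta Heta.
    assert (Hloc : locally (T := CR) (v a) (fun z => Cmod (z - v a)%C < eta)).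
    { apply (locally_le_locally_norm (V := CR)); exists (mkposreal eta Heta).
      intros z Hz; rewrite <- norm_CR; exact Hz. }
    destruct (Hvc a (conj (Rle_refl a) (Rlt_le _ _ Hab)) _ Hloc) as [h Hh].
    exists h; split; [apply h|]; intros p Hp Hph; apply Rlt_le, Hh; [|lra].
    unfold ball; simpl; unfold AbsRing_ball, abs, minus, plus, opp; simpl.
    apply Rabs_lt_between; lra.
Qed.

(** * The amplitude with its power singularity at [p1], and the wave integral on compact
    subintervals *)

Lemma Rpower_pos (x y : R) : 0 < Rpower x y.
Proof. apply exp_pos. Qed.

Lemma Rpower_antitone (x y c : R) : 0 < x -> x <= y -> c <= 0 -> Rpower y c <= Rpower x c.
Proof.
  intros Hx Hxy Hc.
  replace c with (- (- c)) by ring; rewrite !(Rpower_Ropp _ (- c)).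
  apply Rinv_le_contravar; [apply Rpower_pos|apply Rle_Rpower_l; lra].
Qed.

Lemma Rpower_succ (x c : R) : 0 < x -> Rpower x (c + 1) = x * Rpower x c.
Proof. intros Hx; rewrite Rpower_plus, Rpower_1 by assumption; ring. Qed.

Lemma is_derive_Rpower_sub (p1 c p : R) : p1 < p ->
  is_derive (fun q => Rpower (q - p1) c) p (c * Rpower (p - p1) (c - 1)).
Proof.
  intros Hp.
  replace (c * Rpower (p - p1) (c - 1)) with (scal 1 (c * Rpower (p - p1) (c - 1)))
    by (unfold scal; simpl; unfold mult; simpl; ring).
  apply (is_derive_comp (V := R_NormedModule) (fun s => Rpower s c) (fun q => q - p1)).
  - apply is_derive_Reals, derivable_pt_lim_power; lra.
  - auto_derive; [exact I|ring].
Qed.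

Lemma continuous_Rpower_sub (p1 c p : R) : p1 < p ->
  continuous (fun q => Rpower (q - p1) c) p.
Proof.
  intros Hp; apply (ex_derive_continuous (V := R_NormedModule)).
  eexists; apply is_derive_Rpower_sub, Hp.
Qed.

Definition singular (p1 mu : R) (v : R -> C) (p : R) : C :=
  (RtoC (Rpower (p - p1) (mu - 1)) * v p)%C.

Section Singular.
Variables (p1 p2 mu M : R) (v dv : R -> C).
Hypothesis Hmu : 0 < mu < 1 / 2.
Hypothesis Hamp : amplitude p1 p2 v dv M.

Definition dsingular (p : R) : C :=
  (RtoC ((mu - 1) * Rpower (p - p1) (mu - 1 - 1)) * v p
    + RtoC (Rpower (p - p1) (mu - 1)) * dv p)%C.

Lemma continuous_RtoC (f : R -> R) (x : R) :
  continuous f x -> continuous (U := CR) (fun y => RtoC (f y)) x.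
Proof.
  intros Hf; apply continuous_pair_CR;
    [exact Hf|apply (continuous_const (V := R_UniformSpace))].
Qed.

Lemma continuous_amplitude (p : R) : p1 < p < p2 -> continuous (U := CR) v p.
Proof.
  intros Hp; apply (ex_derive_continuous (V := CR)); eexists.
  apply (amplitude_derive _ _ _ _ _ Hamp), Hp.
Qed.

Lemma continuous_singular (p : R) : p1 < p < p2 ->
  continuous (U := CR) (singular p1 mu v) p.
Proof.
  intros Hp; apply continuous_Cmult.
  - apply continuous_RtoC, continuous_Rpower_sub; lra.
  - apply continuous_amplitude, Hp.
Qed.

Lemma is_derive_singular (p : R) : p1 < p < p2 ->
  is_derive (V := CR) (singular p1 mu v) p (dsingular p).
Proof.
  intros Hp.
  apply (is_derive_Cmult (fun q => RtoC (Rpower (q - p1) (mu - 1))));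
    [|apply (amplitude_derive _ _ _ _ _ Hamp), Hp].
  apply (is_derive_pair_CR (fun q => Rpower (q - p1) (mu - 1)) (fun _ => 0)).
  - apply is_derive_Rpower_sub; lra.
  - apply (is_derive_const (V := R_NormedModule)).
Qed.

Lemma continuous_dsingular (p : R) : p1 < p < p2 -> continuous (U := CR) dsingular p.
Proof.
  intros Hp; apply (continuous_plus (V := CR)); apply continuous_Cmult.
  - apply continuous_RtoC, (continuous_scal_r (V := R_NormedModule)),
      continuous_Rpower_sub; lra.
  - apply continuous_amplitude, Hp.
  - apply continuous_RtoC, continuous_Rpower_sub; lra.
  - apply (amplitude_continuous _ _ _ _ _ Hamp), Hp.
Qed.

Lemma Cmod_singular_le (p : R) : p1 < p < p2 ->
  Cmod (singular p1 mu v p) <= M * Rpower (p - p1) (mu - 1).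
Proof.
  intros Hp; unfold singular; rewrite Cmod_mult, Cmod_R.
  assert (H := Rpower_pos (p - p1) (mu - 1)); rewrite Rabs_right by lra.
  assert (Hb := amplitude_bound _ _ _ _ _ Hamp p Hp); nra.
Qed.

(** The first term of the bound is positive since mu < 1; it is written so that the whole bound is
    literally the derivative of - M s^(mu-1) + (M / mu) s^mu, with s = p - p1. *)
Lemma Cmod_dsingular_le (p : R) : p1 < p < p2 ->
  Cmod (dsingular p) <=
    (- M) * ((mu - 1) * Rpower (p - p1) (mu - 1 - 1)) + M * Rpower (p - p1) (mu - 1).
Proof.
  intros Hp; unfold dsingular; eapply Rle_trans; [apply Cmod_triangle|].
  rewrite !Cmod_mult, !Cmod_R.
  assert (H1 := Rpower_pos (p - p1) (mu - 1 - 1)).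
  assert (H2 := Rpower_pos (p - p1) (mu - 1)).
  rewrite (Rabs_left ((mu - 1) * _)), (Rabs_right (Rpower _ _)) by nra.
  assert (Hb := amplitude_bound _ _ _ _ _ Hamp p Hp).
  assert (Hd := amplitude_derive_bound _ _ _ _ _ Hamp p Hp).
  assert (0 < (1 - mu) * Rpower (p - p1) (mu - 1 - 1)) by nra.
  nra.
Qed.

Lemma is_derive_primitive_Rpower (p : R) : p1 < p ->
  is_derive (fun q => M / mu * Rpower (q - p1) mu) p (M * Rpower (p - p1) (mu - 1)).
Proof.
  intros Hp.
  replace (M * Rpower (p - p1) (mu - 1))
    with (M / mu * (mu * Rpower (p - p1) (mu - 1))) by (field; lra).
  apply (is_derive_scal (fun q => Rpower (q - p1) mu)), is_derive_Rpower_sub, Hp.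
Qed.

Definition wave (t x p : R) : C := (singular p1 mu v p * osc t x p)%C.

Lemma continuous_wave (t x p : R) : p1 < p < p2 -> continuous (U := CR) (wave t x) p.
Proof.
  intros Hp; apply continuous_Cmult; [apply continuous_singular, Hp|apply continuous_osc].
Qed.

Lemma ex_RInt_wave (t x a b : R) : p1 < a < p2 -> p1 < b < p2 ->
  ex_RInt (V := CR) (wave t x) a b.
Proof.
  intros Ha Hb; apply ex_RInt_continuous; intros z Hz; apply continuous_wave.
  revert Hz; unfold Rmin, Rmax; destruct Rle_dec; lra.
Qed.

(** The majorant M s^(mu-1) is integrable at 0 because mu > 0. The bound does not involve [a], so it
    persists as [a] tends to [p1]. *)
Lemma wave_le_trivial (t x a b : R) : p1 < a -> a <= b -> b < p2 ->
  Cmod (RInt (V := CR) (wave t x) a b) <= M / mu * Rpower (b - p1) mu.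
Proof.
  intros Ha Hab Hb.
  assert (H0 : 0 < M / mu * Rpower (a - p1) mu).
  { apply Rmult_lt_0_compat; [|apply Rpower_pos].
    apply Rdiv_lt_0_compat; [apply (amplitude_pos _ _ _ _ _ Hamp)|lra]. }
  apply Rle_trans with (M / mu * Rpower (b - p1) mu - M / mu * Rpower (a - p1) mu); [|lra].
  apply (Cmod_RInt_le_primitive _ (fun q => M / mu * Rpower (q - p1) mu)
    (fun q => M * Rpower (q - p1) (mu - 1))); try assumption; intros p Hp.
  - apply continuous_wave; lra.
  - apply is_derive_primitive_Rpower; lra.
  - apply (continuous_scal_r (V := R_NormedModule)), continuous_Rpower_sub; lra.
  - unfold wave, osc; rewrite Cmod_mult, Cmod_cis, Rmult_1_r.
    apply Cmod_singular_le; lra.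
Qed.

(** After integration by parts, the boundary term at [b] cancels against the decrease of s^(mu-1).
    What is left is M (a-p1)^(mu-1) + (M / mu) (b-p1)^mu, and (b-p1)^mu <= (p2-p1) (a-p1)^(mu-1)
    merges the two. *)
Lemma wave_le_osc (t x a b B : R) : p1 < a -> a <= b -> b < p2 ->
  (forall y, a <= y <= b -> Cmod (RInt (V := CR) (osc t x) a y) <= B) ->
  Cmod (RInt (V := CR) (wave t x) a b)
    <= B * (M * (1 + (p2 - p1) / mu) * Rpower (a - p1) (mu - 1)).
Proof.
  intros Ha Hab Hb HB.
  assert (HM := amplitude_pos _ _ _ _ _ Hamp).
  assert (HB0 : 0 <= B)
    by (eapply Rle_trans; [apply Cmod_ge_0|apply (HB a); lra]).
  eapply Rle_trans.
  - apply (Cmod_RInt_mult_le (singular p1 mu v) dsingular (osc t x)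
      (fun q => (- M) * Rpower (q - p1) (mu - 1) + M / mu * Rpower (q - p1) mu)
      (fun q => (- M) * ((mu - 1) * Rpower (q - p1) (mu - 1 - 1))
        + M * Rpower (q - p1) (mu - 1)) a b B); try assumption.
    + intros p Hp; apply is_derive_singular; lra.
    + intros p Hp; apply continuous_dsingular; lra.
    + intros p; apply continuous_osc.
    + intros p Hp; apply (is_derive_plus (V := R_NormedModule)).
      * apply (is_derive_scal (fun q => Rpower (q - p1) (mu - 1))),
          is_derive_Rpower_sub; lra.
      * apply is_derive_primitive_Rpower; lra.
    + intros p Hp; apply (continuous_plus (V := R_NormedModule)).
      * apply (continuous_scal_r (V := R_NormedModule)),
          (continuous_scal_r (V := R_NormedModule)), continuous_Rpower_sub; lra.
      * apply (continuous_scal_r (V := R_NormedModule)), continuous_Rpower_sub; lra.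
    + intros p Hp; apply Cmod_dsingular_le; lra.
  - apply Rmult_le_compat_l; [exact HB0|].
    assert (Hs := Cmod_singular_le b (conj (Rlt_le_trans _ _ _ Ha Hab) Hb)).
    assert (Hpa := Rpower_pos (a - p1) mu).
    assert (Hb1 : Rpower (b - p1) mu <= (p2 - p1) * Rpower (a - p1) (mu - 1)).
    { replace mu with (mu - 1 + 1) at 1 by ring; rewrite Rpower_succ by lra.
      apply Rmult_le_compat; try lra; [apply Rlt_le, Rpower_pos|].
      apply Rpower_antitone; lra. }
    assert (HMm : 0 < M / mu) by (apply Rdiv_lt_0_compat; lra).
    assert (M / mu * Rpower (b - p1) mu
      <= M / mu * ((p2 - p1) * Rpower (a - p1) (mu - 1)))
      by (apply Rmult_le_compat_l; lra).
    replace (M * (1 + (p2 - p1) / mu) * Rpower (a - p1) (mu - 1))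
      with (M * Rpower (a - p1) (mu - 1) + M / mu * ((p2 - p1) * Rpower (a - p1) (mu - 1)))
      by (field; lra).
    assert (0 < M / mu * Rpower (a - p1) mu) by (apply Rmult_lt_0_compat; assumption).
    lra.
Qed.

Lemma wave_le_tail (t d h b kappa : R) :
  0 < t -> 0 < h <= d / 2 -> p1 + d / 2 <= b < p2 -> 0 < kappa -> t * kappa ^ 2 = 1 ->
  Cmod (RInt (V := CR) (wave t (2 * t * (p1 + d))) (p1 + h) b)
    <= M * (1 + (p2 - p1) / mu) *
       (4 / (t * d) * Rpower h (mu - 1) + 6 * kappa * Rpower (d / 2) (mu - 1)).
Proof.
  intros Ht Hh Hb Hk Htk.
  assert (Htd : 0 < t * d) by nra.
  eapply Rle_trans.
  - apply (Cmod_RInt_Chasles _ (p1 + h) (p1 + d / 2) b); try (apply ex_RInt_wave; lra).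
    + apply (wave_le_osc _ _ _ _ (4 / (t * d))); try lra.
      (* For p <= p1 + d/2 the derivative of the phase is 2 t (p1 + d - p) >= t d. *)
      intros y Hy; apply osc_nonstationary; try lra; left; nra.
    + apply (wave_le_osc _ _ _ _ (6 * kappa)); try lra.
      intros y Hy.
      (* The relation t kappa^2 = 1 balances the two terms: 4 / (t kappa) = 4 kappa. *)
      replace (6 * kappa) with (2 * kappa + 4 / (t * kappa)).
      * apply osc_stationary; lra.
      * assert (kappa * (t * kappa) = 1) by lra.
        assert (0 < t * kappa) by nra.
        replace (4 / (t * kappa)) with (4 * kappa); [ring|].
        apply Rmult_eq_reg_r with (t * kappa); [|lra].
        unfold Rdiv; rewrite (Rmult_assoc 4 (/ _)), Rinv_l by lra; lra.
  - replace (p1 + h - p1) with h by ring; replace (p1 + d / 2 - p1) with (d / 2) by ring.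
    lra.
Qed.
End Singular.

(** * Elementary inequalities for powers and trigonometric functions, and the model sine integral *)

Lemma Rpower_eventually_le (c q : R) : c < 0 -> 0 < q ->
  exists X, 1 <= X /\ forall y, X <= y -> Rpower y c <= q.
Proof.
  intros Hc Hq; exists (Rmax 1 (Rpower q (/ c))); split; [apply Rmax_l|intros y Hy].
  replace q with (Rpower (Rpower q (/ c)) c)
    by (rewrite Rpower_mult, Rinv_l, Rpower_1 by lra; reflexivity).
  apply Rpower_antitone; [apply Rpower_pos| |lra].
  eapply Rle_trans; [apply Rmax_r|exact Hy].
Qed.

Lemma Rpower_small (c q : R) : 0 < c -> 0 < q ->
  exists h, 0 < h /\ forall s, 0 < s <= h -> Rpower s c <= q.
Proof.
  intros Hc Hq; exists (Rpower q (/ c)); split; [apply Rpower_pos|intros s Hs].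
  replace q with (Rpower (Rpower q (/ c)) c)
    by (rewrite Rpower_mult, Rinv_l, Rpower_1 by lra; reflexivity).
  apply Rle_Rpower_l; lra.
Qed.

Lemma Rabs_sin_le (y : R) : Rabs (sin y) <= Rabs y.
Proof.
  assert (H : forall z, 0 < z -> Rabs (sin z) <= z).
  { intros z Hz; apply Rabs_le_between; split; [|apply Rlt_le, sin_lt_x, Hz].
    destruct (Rle_dec z 1) as [Hz1|Hz1].
    - assert (0 <= sin z) by (apply sin_ge_0; assert (H := PI2_1); lra); lra.
    - assert (H := SIN_bound z); lra. }
  destruct (Rtotal_order y 0) as [Hy|[->|Hy]].
  - rewrite <- (Rabs_Ropp (sin y)), <- sin_neg, (Rabs_left y) by lra.
    apply H; lra.
  - rewrite sin_0; lra.
  - rewrite (Rabs_right y) by lra; apply H, Hy.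
Qed.

Lemma one_minus_cos_le (y : R) : 2 * (1 - cos y) <= y ^ 2.
Proof.
  replace y with (2 * (y / 2)) at 1 by field; rewrite cos_2a_sin.
  assert (H := Rabs_sin_le (y / 2)).
  apply Rsqr_le_abs_1 in H; unfold Rsqr in H; nra.
Qed.

(** The squared modulus is 2 (1 - cos y). *)
Lemma Cmod_cis_minus_1_le (y : R) : Cmod (cis y - 1)%C <= Rabs y.
Proof.
  rewrite <- sqrt_Rsqr_abs; apply sqrt_le_1_alt; simpl.
  assert (H := one_minus_cos_le y); assert (H1 := sin2_cos2 y).
  unfold Rsqr in *; nra.
Qed.

(** The limit has to be one-sided and punctured: [Rpower] takes the value 1 at 0. *)
Lemma filterlim_Rpower_at_right (p1 c K : R) : 0 < c -> 0 < K ->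
  filterlim (fun q => K * Rpower (q - p1) c) (at_right p1) (locally 0).
Proof.
  intros Hc HK P [e He].
  assert (Hq : 0 < e / (2 * K)) by (apply Rdiv_lt_0_compat; [apply e|lra]).
  destruct (Rpower_small c _ Hc Hq) as (h & Hh & Hs).
  apply (filter_imp (F := at_right p1) (fun q => p1 < q < p1 + h));
    [|apply at_right_interval; lra].
  intros q Hq1; apply He; unfold ball; simpl.
  unfold AbsRing_ball, abs, minus, plus, opp; simpl.
  assert (Hp := Rpower_pos (q - p1) c); specialize (Hs (q - p1) ltac:(lra)).
  rewrite Rabs_right by nra.
  apply Rmult_le_compat_l with (r := K) in Hs; [|lra].
  replace (K * (e / (2 * K))) with (e / 2) in Hs by (field; lra).
  assert (He0 := cond_pos e); lra.
Qed.

(* Integrating [s^(mu-1) sin(omega s)] by parts against [(1 - cos(omega s)) / omega]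
   leaves the positive integrand [s^(mu-2) (1 - cos(omega s))], whose integral
   is bounded below on [1 <= omega s <= 2] alone. *)
Lemma sine_integral_ge (p1 mu omega eta h l : R) :
  0 < mu < 1 -> 0 < omega -> 0 < eta -> omega * eta <= 1 -> 2 <= omega * h ->
  is_RInt (fun p => Rpower (p - p1) (mu - 1) * sin (omega * (p - p1)))
    (p1 + eta) (p1 + h) l ->
  (1 - mu) * (1 - cos 1) * Rpower 2 (mu - 2) * Rpower omega (- mu) - Rpower eta mu <= l.
Proof.
  intros Hmu Hom Heta Hoeta Hoh Hl.
  assert (Heh : eta <= h) by nra.
  set (F := fun p => Rpower (p - p1) (mu - 1) * ((1 - cos (omega * (p - p1))) / omega)).
  set (r := fun p => Rpower (p - p1) (mu - 1 - 1) * (1 - cos (omega * (p - p1)))).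
  set (g := fun p => Rpower (p - p1) (mu - 1) * sin (omega * (p - p1))) in Hl.
  assert (Hgc : forall p, p1 < p -> continuous g p).
  { intros p Hp; apply (continuous_mult (K := R_AbsRing)).
    - apply continuous_Rpower_sub, Hp.
    - apply (ex_derive_continuous (V := R_NormedModule)); auto_derive; exact I. }
  assert (Hrc : forall p, p1 < p -> continuous r p).
  { intros p Hp; apply (continuous_mult (K := R_AbsRing)).
    - apply continuous_Rpower_sub, Hp.
    - apply (ex_derive_continuous (V := R_NormedModule)); auto_derive; exact I. }
  assert (Hr0 : forall p, 0 <= r p).
  { intros p; apply Rmult_le_pos; [apply Rlt_le, Rpower_pos|].
    assert (H := COS_bound (omega * (p - p1))); lra. }
  assert (Hrex : forall u w, 0 < u -> 0 < w -> ex_RInt r (p1 + u) (p1 + w)).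
  { intros u w Hu Hw; apply (ex_RInt_continuous (V := R_CompleteNormedModule)).
    intros z Hz; apply Hrc; revert Hz; unfold Rmin, Rmax; destruct Rle_dec; lra. }
  assert (HF : is_RInt (fun p => (mu - 1) / omega * r p + g p) (p1 + eta) (p1 + h)
    (F (p1 + h) - F (p1 + eta))).
  { apply (is_RInt_derive (V := R_CompleteNormedModule));
      rewrite Rmin_left, Rmax_right by lra; intros p Hp.
    - replace ((mu - 1) / omega * r p + g p) with
        ((mu - 1) * Rpower (p - p1) (mu - 1 - 1) * ((1 - cos (omega * (p - p1))) / omega)
          + Rpower (p - p1) (mu - 1) * sin (omega * (p - p1)))
        by (unfold r, g; field; lra).
      apply (Derive.is_derive_mult (fun q => Rpower (q - p1) (mu - 1))
        (fun q => (1 - cos (omega * (q - p1))) / omega));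
        [apply is_derive_Rpower_sub; lra|].
      auto_derive; [exact I|unfold Rminus; field; lra].
    - apply (continuous_plus (V := R_NormedModule)); [|apply Hgc; lra].
      apply (continuous_scal_r (V := R_NormedModule)), Hrc; lra. }
  assert (Hi1 : 0 < / omega) by (apply Rinv_0_lt_compat, Hom).
  assert (Hoi : omega * / omega = 1) by (apply Rinv_r; lra).
  assert (Hetai : eta <= / omega) by nra.
  assert (Hhi : 2 * / omega <= h) by nra.
  assert (Hr : is_RInt r (p1 + eta) (p1 + h) (RInt r (p1 + eta) (p1 + h)))
    by (apply (RInt_correct (V := R_CompleteNormedModule)), Hrex; lra).
  assert (Hl' : l = F (p1 + h) - F (p1 + eta)
    + (1 - mu) / omega * RInt r (p1 + eta) (p1 + h)).
  { apply (is_RInt_scal _ _ _ ((mu - 1) / omega)) in Hr.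
    assert (H := is_RInt_plus _ _ _ _ _ _ Hr Hl).
    apply (is_RInt_unique (V := R_CompleteNormedModule)) in H, HF.
    assert (He : (mu - 1) / omega * RInt r (p1 + eta) (p1 + h) + l
      = F (p1 + h) - F (p1 + eta)) by (rewrite <- HF; symmetry; exact H).
    lra. }
  assert (HFh : 0 <= F (p1 + h)).
  { apply Rmult_le_pos; [apply Rlt_le, Rpower_pos|].
    assert (H := COS_bound (omega * (p1 + h - p1))).
    apply Rmult_le_pos; lra. }
  (* Here 1 - cos y <= y^2 / 2 <= y for y = omega eta in (0, 1], so the boundary term is at most
     eta^(mu-1) eta. *)
  assert (HFe : F (p1 + eta) <= Rpower eta mu).
  { unfold F; replace (p1 + eta - p1) with eta by ring.
    replace mu with (mu - 1 + 1) at 2 by ring; rewrite Rpower_succ, (Rmult_comm eta) by lra.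
    apply Rmult_le_compat_l; [apply Rlt_le, Rpower_pos|].
    assert (H := one_minus_cos_le (omega * eta)).
    apply Rmult_le_reg_r with omega; [exact Hom|].
    unfold Rdiv; rewrite Rmult_assoc, Rinv_l by lra.
    assert (0 < omega * eta) by nra; nra. }
  assert (Hcos : 0 < 1 - cos 1).
  { assert (cos 1 < cos 0); [|rewrite cos_0 in *; lra].
    apply cos_decreasing_1; assert (H := PI2_1); lra. }
  (* On this interval of length 1 / omega, both factors of [r] are replaced by lower bounds: the
     power by its value at the right end, 1 - cos by its value at the left end. *)
  assert (Hmid : (1 - cos 1) * Rpower (2 * / omega) (mu - 1 - 1) * / omega
    <= RInt r (p1 + / omega) (p1 + 2 * / omega)).
  { replace ((1 - cos 1) * Rpower (2 * / omega) (mu - 1 - 1) * / omega) with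
      (RInt (fun _ => (1 - cos 1) * Rpower (2 * / omega) (mu - 1 - 1))
        (p1 + / omega) (p1 + 2 * / omega))
      by (rewrite RInt_const; unfold scal; simpl; unfold mult; simpl; ring).
    apply RInt_le; [lra|apply ex_RInt_const|apply Hrex; lra|].
    intros p Hp; unfold r; rewrite Rmult_comm.
    assert (1 <= omega * (p - p1) <= 2) by nra.
    apply Rmult_le_compat; try lra; [apply Rlt_le, Rpower_pos| |].
    - apply Rpower_antitone; lra.
    - assert (cos (omega * (p - p1)) <= cos 1); [|lra].
      apply cos_decr_1; assert (H' := PI2_1); lra. }
  assert (Hall : RInt r (p1 + / omega) (p1 + 2 * / omega) <= RInt r (p1 + eta) (p1 + h)).
  { rewrite <- (RInt_Chasles r (p1 + eta) (p1 + / omega) (p1 + h)) by (apply Hrex; lra).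
    rewrite <- (RInt_Chasles r (p1 + / omega) (p1 + 2 * / omega) (p1 + h))
      by (apply Hrex; lra).
    unfold plus; simpl.
    assert (0 <= RInt r (p1 + eta) (p1 + / omega))
      by (apply RInt_ge_0; [lra|apply Hrex; lra|auto]).
    assert (0 <= RInt r (p1 + 2 * / omega) (p1 + h))
      by (apply RInt_ge_0; [lra|apply Hrex; lra|auto]).
    lra. }
  assert (Hpow : (1 - mu) * (1 - cos 1) * Rpower 2 (mu - 2) * Rpower omega (- mu)
    = (1 - mu) / omega * ((1 - cos 1) * Rpower (2 * / omega) (mu - 1 - 1) * / omega)).
  { rewrite <- Rpower_mult_distr by lra.
    replace (Rpower (/ omega) (mu - 1 - 1)) with (omega * omega * Rpower omega (- mu)).
    - replace (mu - 1 - 1) with (mu - 2) by ring; field; lra.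
    - rewrite Rmult_assoc, <- !Rpower_succ by assumption.
      unfold Rpower; rewrite ln_Rinv by assumption; f_equal; ring. }
  rewrite Hpow, Hl'.
  assert (Hc : 0 < (1 - mu) / omega) by (apply Rdiv_lt_0_compat; lra).
  assert (Hfin : (1 - mu) / omega * ((1 - cos 1) * Rpower (2 * / omega) (mu - 1 - 1) * / omega)
    <= (1 - mu) / omega * RInt r (p1 + eta) (p1 + h)) by (apply Rmult_le_compat_l; lra).
  lra.
Qed.

(** * Upper and lower bounds for the improper wave integral *)

Lemma Cmod_triangle_sub (z w : C) : Cmod z <= Cmod w + Cmod (w - z)%C.
Proof.
  replace z with (w + - (w - z))%C at 1 by ring.
  eapply Rle_trans; [apply Cmod_triangle|]; rewrite Cmod_opp; apply Rle_refl.
Qed.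

(** Taylor expansion of the phase at [p1]: with s = p - p1 it is a constant plus 2 t d s - t s^2.
    Near [p1] the linear term drives the oscillation and the quadratic one is an error. *)
Lemma osc_shift (t p1 d p : R) :
  osc t (2 * t * (p1 + d)) p =
    (osc t (2 * t * (p1 + d)) p1
      * (cis (2 * t * d * (p - p1)) * cis (- (t * (p - p1) ^ 2))))%C.
Proof. unfold osc; rewrite <- !cis_plus; f_equal; ring. Qed.

Section Solution.
Variables (p1 p2 mu M : R) (v dv : R -> C).
Hypothesis Hp12 : p1 < p2.
Hypothesis Hmu : 0 < mu < 1 / 2.
Hypothesis Hamp : amplitude p1 p2 v dv M.

Lemma ex_RInt_gen_wave (t x : R) :
  ex_RInt_gen (V := CR) (wave p1 mu v t x) (at_right p1) (at_left p2).
Proof.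
  assert (HM : 0 < M / mu)
    by (apply Rdiv_lt_0_compat; [apply (amplitude_pos _ _ _ _ _ Hamp)|lra]).
  apply ex_RInt_gen_dominated with (Phi := fun q => M / mu * Rpower (q - p1) mu)
    (phi := fun q => M * Rpower (q - p1) (mu - 1)) (la := 0)
    (lb := M / mu * Rpower (p2 - p1) mu); try assumption.
  - intros q Hq; apply (continuous_wave p1 p2 mu M v dv); assumption.
  - intros q Hq; apply is_derive_primitive_Rpower; [assumption|lra].
  - intros q Hq; apply (continuous_scal_r (V := R_NormedModule)), continuous_Rpower_sub; lra.
  - intros q Hq; unfold wave, osc; rewrite Cmod_mult, Cmod_cis, Rmult_1_r.
    apply (Cmod_singular_le p1 p2 mu M v dv); assumption.
  - apply filterlim_Rpower_at_right; lra.
  - intros P HP; apply filter_le_within.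
    apply (continuous_scal_r (V := R_NormedModule) (M / mu) (fun q => Rpower (q - p1) mu) p2);
      [apply continuous_Rpower_sub, Hp12|exact HP].
Qed.

(** Comparison with the model integrand v(p1) s^(mu-1) exp(i omega s), omega = 2 t d, up to a
    unimodular constant. The imaginary part of the model integral is a sine integral bounded below;
    the subtracted terms account for starting at [u] instead of [p1] and for the error of the
    comparison. *)
Lemma wave_head_ge (t d h u eta : R) :
  0 < t -> 0 < d -> 0 < h -> 1 <= t * d * h -> p1 + h < p2 ->
  p1 < u -> 2 * t * d * (u - p1) <= 1 ->
  (forall p, p1 < p <= p1 + h -> Cmod (v p - v p1)%C <= eta) ->
  Cmod (v p1) * ((1 - mu) * (1 - cos 1) * Rpower 2 (mu - 2) * Rpower (2 * t * d) (- mu)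
      - Rpower (u - p1) mu)
    - (eta + Cmod (v p1) * (t * h ^ 2)) / mu * Rpower h mu
  <= Cmod (RInt (V := CR) (wave p1 mu v t (2 * t * (p1 + d))) u (p1 + h)).
Proof.
  intros Ht Hd Hh Hth Hph Hu Hu1 Heta.
  set (x := 2 * t * (p1 + d)); set (omega := 2 * t * d) in *.
  assert (Htd : 0 < t * d) by nra.
  assert (Huh : u <= p1 + h) by (unfold omega in *; nra).
  set (z := (osc t x p1 * v p1)%C).
  set (m := fun p => (RtoC (Rpower (p - p1) (mu - 1)) * cis (omega * (p - p1)))%C).
  assert (Hcis : forall p, continuous (U := CR) (fun q => cis (omega * (q - p1))) p).
  { intros p; apply continuous_pair_CR;
      apply (ex_derive_continuous (V := R_NormedModule)); auto_derive; exact I. }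
  assert (Hmc : forall p, p1 < p -> continuous (U := CR) m p).
  { intros p Hp; apply continuous_Cmult; [|apply Hcis].
    apply continuous_RtoC, continuous_Rpower_sub, Hp. }
  assert (Hwc : forall p, p1 < p < p2 -> continuous (U := CR) (wave p1 mu v t x) p)
    by (intros p Hp; apply (continuous_wave p1 p2 mu M v dv); assumption).
  assert (Hm : is_RInt (V := CR) m u (p1 + h) (RInt (V := CR) m u (p1 + h))).
  { apply (RInt_correct (V := CR)), ex_RInt_continuous.
    rewrite Rmin_left, Rmax_right by assumption; intros; apply Hmc; lra. }
  assert (Hw : is_RInt (V := CR) (wave p1 mu v t x) u (p1 + h)
    (RInt (V := CR) (wave p1 mu v t x) u (p1 + h))).
  { apply (RInt_correct (V := CR)), ex_RInt_continuous.
    rewrite Rmin_left, Rmax_right by assumption; intros; apply Hwc; lra. }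
  set (W := RInt (V := CR) (wave p1 mu v t x) u (p1 + h)) in *.
  set (I := RInt (V := CR) m u (p1 + h)) in *.
  assert (HI : (1 - mu) * (1 - cos 1) * Rpower 2 (mu - 2) * Rpower omega (- mu)
    - Rpower (u - p1) mu <= Cmod I).
  { apply Rle_trans with (Im I).
    - apply (sine_integral_ge p1 mu omega (u - p1) h); unfold omega in *; try lra; try nra.
      replace (p1 + (u - p1)) with u by ring.
      apply (is_RInt_ext (fun p => Im (m p))); [|apply is_RInt_Im_CR, Hm].
      intros p _; unfold m; rewrite im_scal_l; reflexivity.
    - eapply Rle_trans; [apply Rle_abs|].
      eapply Rle_trans; [|apply Rmax_Cmod]; apply Rmax_r. }
  assert (Herr : Cmod (W - z * I)%C
    <= (eta + Cmod (v p1) * (t * h ^ 2)) / mu * Rpower (p1 + h - p1) mu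
      - (eta + Cmod (v p1) * (t * h ^ 2)) / mu * Rpower (u - p1) mu).
  { assert (Hd0 := is_RInt_minus (V := CR) _ _ _ _ _ _ Hw (is_RInt_Cmult_l z _ _ _ _ Hm)).
    rewrite <- (is_RInt_unique (V := CR) _ _ _ _ Hd0 : _ = (W - z * I)%C).
    apply (Cmod_RInt_le_primitive _
      (fun q => (eta + Cmod (v p1) * (t * h ^ 2)) / mu * Rpower (q - p1) mu)
      (fun q => (eta + Cmod (v p1) * (t * h ^ 2)) * Rpower (q - p1) (mu - 1)));
      try assumption; intros p Hp.
    - apply (continuous_minus (V := CR)); [apply Hwc; lra|].
      apply continuous_Cmult; [apply (continuous_const (V := CR))|apply Hmc; lra].
    - apply is_derive_primitive_Rpower; [assumption|lra].
    - apply (continuous_scal_r (V := R_NormedModule)), continuous_Rpower_sub; lra.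
    - set (e := cis (omega * (p - p1))); set (f := cis (- (t * (p - p1) ^ 2))).
      change (Cmod (wave p1 mu v t x p - z * m p)%C
        <= (eta + Cmod (v p1) * (t * h ^ 2)) * Rpower (p - p1) (mu - 1)).
      (* The error splits in two: freezing [v] at [p1] costs at most [eta], and dropping the
         quadratic phase [f] costs |v(p1)| |f - 1| <= |v(p1)| t h^2. Besides the power, the common
         factors are unimodular. *)
      replace (wave p1 mu v t x p - z * m p)%C with
        (RtoC (Rpower (p - p1) (mu - 1)) * (osc t x p1 * e
          * ((v p - v p1) * f + v p1 * (f - 1))))%C.
      + assert (Hpos := Rpower_pos (p - p1) (mu - 1)).
        rewrite Cmod_mult, Cmod_R, Rabs_right, Rmult_comm by lra.
        apply Rmult_le_compat_r; [lra|].
        unfold osc, e; rewrite !Cmod_mult, !Cmod_cis, !Rmult_1_l.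
        eapply Rle_trans; [apply Cmod_triangle|].
        rewrite !Cmod_mult; unfold f; rewrite Cmod_cis, Rmult_1_r.
        apply Rplus_le_compat; [apply Heta; lra|].
        apply Rmult_le_compat_l; [apply Cmod_ge_0|].
        eapply Rle_trans; [apply Cmod_cis_minus_1_le|].
        rewrite Rabs_Ropp, Rabs_right
          by (apply Rle_ge, Rmult_le_pos; [lra|apply pow2_ge_0]).
        apply Rmult_le_compat_l; [lra|apply pow_incr; lra].
      + unfold wave, singular, z, m.
        replace (osc t x p) with (osc t x p1 * (e * f))%C by (symmetry; apply osc_shift).
        fold e; ring. }
  assert (Hz : Cmod z = Cmod (v p1))
    by (unfold z, osc; rewrite Cmod_mult, Cmod_cis, Rmult_1_l; reflexivity).
  replace (p1 + h - p1) with h in Herr by ring.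
  assert (Heta0 : 0 <= eta)
    by (eapply Rle_trans; [apply Cmod_ge_0|apply (Heta (p1 + h)); lra]).
  assert (0 <= (eta + Cmod (v p1) * (t * h ^ 2)) / mu * Rpower (u - p1) mu).
  { apply Rmult_le_pos; [|apply Rlt_le, Rpower_pos].
    assert (H1 := Cmod_ge_0 (v p1)).
    apply Rmult_le_pos; [|apply Rlt_le, Rinv_0_lt_compat; lra].
    apply Rplus_le_le_0_compat; [lra|].
    apply Rmult_le_pos; [lra|apply Rmult_le_pos; [lra|apply pow2_ge_0]]. }
  assert (Htri := Cmod_triangle_sub (z * I)%C W).
  rewrite Cmod_mult, Hz in Htri.
  apply Rmult_le_compat_l with (r := Cmod (v p1)) in HI; [|apply Cmod_ge_0].
  lra.
Qed.

(** Comparing exponents, t^(-1/2) d^(mu-1) = (t d)^(-mu) (t d^2)^(mu-1/2); the factor 2 absorbs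
    2^(1-mu). *)
Lemma Rpower_stationary (t d : R) : 0 < t -> 0 < d ->
  Rpower t (- / 2) * Rpower (d / 2) (mu - 1)
    <= 2 * (Rpower (t * d) (- mu) * Rpower (t * d ^ 2) (mu - / 2)).
Proof.
  intros Ht Hd.
  replace (Rpower (d / 2) (mu - 1)) with (Rpower 2 (1 - mu) * Rpower d (mu - 1)).
  - replace (Rpower (t * d) (- mu) * Rpower (t * d ^ 2) (mu - / 2))
      with (Rpower t (- / 2) * Rpower d (mu - 1)).
    + assert (H : Rpower 2 (1 - mu) <= 2).
      { rewrite <- (Rpower_1 2) at 2 by lra; apply Rle_Rpower; lra. }
      assert (H1 := Rpower_pos t (- / 2)); assert (H2 := Rpower_pos d (mu - 1)).
      assert (H3 : 0 < Rpower t (- / 2) * Rpower d (mu - 1)) by nra.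
      nra.
    + unfold Rpower; rewrite <- !exp_plus; f_equal.
      replace (d ^ 2) with (d * d) by ring.
      rewrite !ln_mult by nra; field.
  - unfold Rpower; rewrite <- exp_plus; f_equal.
    unfold Rdiv; rewrite ln_mult, ln_Rinv by lra; ring.
Qed.

Lemma Rpower_half_sqr (t : R) : 0 < t -> t * Rpower t (- / 2) ^ 2 = 1.
Proof.
  intros Ht; simpl; rewrite Rmult_1_r, <- Rpower_plus.
  replace (- / 2 + - / 2) with (- (1)) by field.
  rewrite Rpower_Ropp, Rpower_1 by assumption; field; lra.
Qed.

(** The cuts are h = A / (t d) and kappa = t^(-1/2). The hypothesis 2 A <= t d^2 says that h <= d/2,
    and both contributions scale like (t d)^(-mu). *)
Lemma wave_le_tail_Rpower (t d A b : R) :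
  0 < t -> 0 < d -> 0 < A -> 2 * A <= t * d ^ 2 -> p1 + d / 2 <= b < p2 ->
  Cmod (RInt (V := CR) (wave p1 mu v t (2 * t * (p1 + d))) (p1 + A / (t * d)) b)
    <= M * (1 + (p2 - p1) / mu) * Rpower (t * d) (- mu) *
       (4 * Rpower A (mu - 1) + 12 * Rpower (t * d ^ 2) (mu - / 2)).
Proof.
  intros Ht Hd HA HN Hb.
  assert (Htd : 0 < t * d) by nra.
  assert (Hh : 0 < A / (t * d)) by (apply Rdiv_lt_0_compat; lra).
  assert (Hhd : A / (t * d) <= d / 2).
  { apply Rmult_le_reg_r with (t * d); [exact Htd|].
    unfold Rdiv at 1; rewrite Rmult_assoc, Rinv_l by lra; lra. }
  eapply Rle_trans.
  - apply (wave_le_tail p1 p2 mu M v dv Hmu Hamp t d (A / (t * d)) b (Rpower t (- / 2)));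
      try assumption; [lra|apply Rpower_pos|apply Rpower_half_sqr, Ht].
  - assert (HC : 0 < M * (1 + (p2 - p1) / mu)).
    { assert (0 < (p2 - p1) / mu) by (apply Rdiv_lt_0_compat; lra).
      assert (HM := amplitude_pos _ _ _ _ _ Hamp); nra. }
    rewrite (Rmult_assoc _ (Rpower (t * d) _)); apply Rmult_le_compat_l; [lra|].
    assert (H1 := Rpower_stationary t d Ht Hd).
    replace (4 / (t * d) * Rpower (A / (t * d)) (mu - 1))
      with (4 * (Rpower (t * d) (- mu) * Rpower A (mu - 1))); [lra|].
    replace (Rpower (A / (t * d)) (mu - 1))
      with (t * d * (Rpower (t * d) (- mu) * Rpower A (mu - 1))).
    + field; split; lra.
    + rewrite <- Rmult_assoc, <- Rpower_succ by assumption.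
      unfold Rpower; rewrite <- exp_plus; f_equal.
      unfold Rdiv; rewrite (ln_mult A), ln_Rinv by (try apply Rinv_0_lt_compat; assumption); ring.
Qed.

Lemma solution_le_trivial (t x : R) (l : C) :
  is_RInt_gen (V := CR) (wave p1 mu v t x) (at_right p1) (at_left p2) l ->
  Cmod l <= M / mu * Rpower (p2 - p1) mu.
Proof.
  intros Hl; apply le_epsilon; intros e He.
  destruct (is_RInt_gen_approx _ p1 p2 ((p1 + p2) / 2) ((p1 + p2) / 2) _ e
    ltac:(lra) ltac:(lra) He Hl) as (a & b & Ha & Hb & Happ).
  assert (Hw := wave_le_trivial p1 p2 mu M v dv Hmu Hamp t x a b ltac:(lra) ltac:(lra) ltac:(lra)).
  assert (Hmono : Rpower (b - p1) mu <= Rpower (p2 - p1) mu) by (apply Rle_Rpower_l; lra).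
  assert (HM : 0 < M / mu)
    by (apply Rdiv_lt_0_compat; [apply (amplitude_pos _ _ _ _ _ Hamp)|lra]).
  assert (M / mu * Rpower (b - p1) mu <= M / mu * Rpower (p2 - p1) mu)
    by (apply Rmult_le_compat_l; lra).
  set (J := RInt (V := CR) (wave p1 mu v t x) a b : C) in *.
  assert (Htri := Cmod_triangle_sub l J).
  lra.
Qed.

(** The cut uses A = 1/2, the largest value that t d^2 >= 1 permits. Then A^(mu-1) <= 2 and (t
    d^2)^(mu-1/2) <= 1, whence 20 = 4 * 2 + 12. *)
Lemma solution_le (t d : R) (l : C) :
  0 < t -> 0 < d < p2 - p1 -> 1 <= t * d ^ 2 ->
  is_RInt_gen (V := CR) (wave p1 mu v t (2 * t * (p1 + d))) (at_right p1) (at_left p2) l ->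
  Cmod l <= (M / mu + 20 * (M * (1 + (p2 - p1) / mu))) * Rpower (t * d) (- mu).
Proof.
  intros Ht Hd HN Hl; apply le_epsilon; intros e He.
  assert (Htd : 0 < t * d) by nra.
  assert (HM := amplitude_pos _ _ _ _ _ Hamp).
  assert (HMm : 0 < M / mu) by (apply Rdiv_lt_0_compat; lra).
  assert (HC : 0 < M * (1 + (p2 - p1) / mu)).
  { assert (0 < (p2 - p1) / mu) by (apply Rdiv_lt_0_compat; lra); nra. }
  set (h := 1 / 2 / (t * d)).
  assert (Hh : 0 < h) by (apply Rdiv_lt_0_compat; lra).
  assert (Hhtd : h * (t * d) = 1 / 2)
    by (unfold h, Rdiv; rewrite (Rmult_assoc (1 * / 2)), Rinv_l by lra; lra).
  assert (Hhd : h <= d / 2) by (apply Rmult_le_reg_r with (t * d); lra).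
  destruct (is_RInt_gen_approx _ p1 p2 (p1 + h) (p1 + d / 2) _ e
    ltac:(lra) ltac:(lra) He Hl) as (a & b & Ha & Hb & Happ).
  set (x := 2 * t * (p1 + d)) in *.
  set (J := RInt (V := CR) (wave p1 mu v t x) a b : C) in *.
  assert (HJ : Cmod J <= M / mu * Rpower h mu + M * (1 + (p2 - p1) / mu)
    * Rpower (t * d) (- mu)
    * (4 * Rpower (1 / 2) (mu - 1) + 12 * Rpower (t * d ^ 2) (mu - / 2))).
  { apply (Cmod_RInt_Chasles _ a (p1 + h) b);
      try (apply (ex_RInt_wave p1 p2 mu M v dv); try assumption; lra).
    - replace h with (p1 + h - p1) at 2 by ring.
      apply (wave_le_trivial p1 p2 mu M v dv); try assumption; lra.
    - apply wave_le_tail_Rpower; lra. }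
  assert (Hhm : Rpower h mu <= Rpower (t * d) (- mu)).
  { replace (Rpower (t * d) (- mu)) with (Rpower (/ (t * d)) mu)
      by (unfold Rpower; rewrite ln_Rinv by assumption; f_equal; ring).
    apply Rle_Rpower_l; [lra|split; [exact Hh|]].
    apply Rmult_le_reg_r with (t * d); [exact Htd|]; rewrite Rinv_l by lra; lra. }
  assert (H2 : Rpower (1 / 2) (mu - 1) <= 2).
  { replace 2 with (Rpower (1 / 2) (- (1))) at 2
      by (rewrite Rpower_Ropp, Rpower_1 by lra; field).
    replace (1 / 2) with (/ 2) by field.
    unfold Rpower; rewrite ln_Rinv by lra.
    assert (0 < ln 2) by (rewrite <- ln_1; apply ln_increasing; lra).
    apply Rnot_lt_le; intros Hc; apply exp_lt_inv in Hc; nra. }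
  assert (H3 : Rpower (t * d ^ 2) (mu - / 2) <= 1).
  { rewrite <- (Rpower_O (t * d ^ 2)) by lra; apply Rle_Rpower; lra. }
  assert (HS := Rpower_pos (t * d) (- mu)).
  assert (H4 : M * (1 + (p2 - p1) / mu) * Rpower (t * d) (- mu)
    * (4 * Rpower (1 / 2) (mu - 1) + 12 * Rpower (t * d ^ 2) (mu - / 2))
    <= M * (1 + (p2 - p1) / mu) * Rpower (t * d) (- mu) * 20)
    by (apply Rmult_le_compat_l; [nra|lra]).
  assert (H5 : M / mu * Rpower h mu <= M / mu * Rpower (t * d) (- mu))
    by (apply Rmult_le_compat_l; lra).
  assert (Htri := Cmod_triangle_sub l J).
  lra.
Qed.

(** The main term is c1 (t d)^(-mu). Six errors of at most one eighth of it are allowed: two from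
    the tail, two from the comparison near [p1], one from the left endpoint and one from truncating
    the improper integral. This leaves c1 / 4. The constants are fixed in the order [A], then [eta],
    then the threshold for t d^2. *)
Lemma solution_ge :
  v p1 <> RtoC 0 ->
  (forall eta, 0 < eta -> exists h, 0 < h /\
     forall p, p1 < p < p2 -> p < p1 + h -> Cmod (v p - v p1)%C <= eta) ->
  exists c N0 d0, 0 < c /\ 0 < N0 /\ 0 < d0 /\
    forall (t d : R) (l : C), 0 < t -> 0 < d <= d0 -> N0 <= t * d ^ 2 ->
    is_RInt_gen (V := CR) (wave p1 mu v t (2 * t * (p1 + d))) (at_right p1) (at_left p2) l ->
    c * Rpower (t * d) (- mu) <= Cmod l.
Proof.
  intros Hv0 Hcont.
  assert (HV : 0 < Cmod (v p1)) by (apply Cmod_gt_0, Hv0).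
  assert (HM := amplitude_pos _ _ _ _ _ Hamp).
  set (C1 := M * (1 + (p2 - p1) / mu)).
  assert (HC1 : 0 < C1).
  { unfold C1; assert (0 < (p2 - p1) / mu) by (apply Rdiv_lt_0_compat; lra); nra. }
  assert (Hcos : 0 < 1 - cos 1).
  { assert (cos 1 < cos 0); [|rewrite cos_0 in *; lra].
    apply cos_decreasing_1; assert (H := PI2_1); lra. }
  set (c0 := (1 - mu) * (1 - cos 1) * Rpower 2 (mu - 2) * Rpower 2 (- mu)).
  assert (Hc0 : 0 < c0)
    by (unfold c0; repeat apply Rmult_lt_0_compat; try apply Rpower_pos; lra).
  set (c1 := Cmod (v p1) * c0).
  assert (Hc1 : 0 < c1) by (unfold c1; nra).
  (* Since mu < 1, a large [A] makes the nonstationary part of the tail small; [c1] does not depend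
     on [A]. *)
  destruct (Rpower_eventually_le (mu - 1) (c1 / 8 / (C1 * 4))) as (A & HA1 & HA);
    [lra|apply Rdiv_lt_0_compat; lra|].
  specialize (HA A (Rle_refl A)).
  apply Rmult_le_compat_l with (r := C1 * 4) in HA; [|lra].
  replace (C1 * 4 * (c1 / 8 / (C1 * 4))) with (c1 / 8) in HA by (field; lra).
  assert (HAm := Rpower_pos A mu).
  (* This tolerance makes eta h^mu / mu equal to c1/8 times (t d)^(-mu), because h^mu = A^mu (t
     d)^(-mu). *)
  destruct (Hcont (c1 / 8 * mu / Rpower A mu)) as (h0 & Hh0 & Heta);
    [apply Rdiv_lt_0_compat; [|exact HAm]; apply Rmult_lt_0_compat; lra|].
  set (eta := c1 / 8 * mu / Rpower A mu) in *.
  destruct (Rpower_eventually_le (mu - / 2) (c1 / 8 / (C1 * 12))) as (N1 & HN1 & HN);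
    [lra|apply Rdiv_lt_0_compat; lra|].
  (* Above this threshold the quadratic phase error is small: t h^2 = A^2 / (t d^2). The threshold
     [N1] plays the same role for the part of the tail that crosses the stationary point. *)
  set (N2 := Cmod (v p1) * A ^ 2 * Rpower A mu / mu / (c1 / 8)).
  exists (c1 / 4), (Rmax (2 * A) (Rmax N1 N2)), (Rmin h0 ((p2 - p1) / 2)).
  assert (HR1 := Rmax_l (2 * A) (Rmax N1 N2)); assert (HR2 := Rmax_r (2 * A) (Rmax N1 N2)).
  assert (HR3 := Rmax_l N1 N2); assert (HR4 := Rmax_r N1 N2).
  repeat split; [lra|lra|apply Rmin_glb_lt; lra|].
  intros t d l Ht [Hd Hd0] HtN Hl.
  assert (Hd1 := Rle_trans _ _ _ Hd0 (Rmin_l _ _)).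
  assert (Hd2 := Rle_trans _ _ _ Hd0 (Rmin_r _ _)).
  assert (Htd : 0 < t * d) by nra.
  set (S := Rpower (t * d) (- mu)); assert (HS : 0 < S) by apply Rpower_pos.
  set (N := t * d ^ 2) in *; assert (HNpos : 0 < N) by lra.
  specialize (HN N ltac:(lra)).
  apply Rmult_le_compat_l with (r := C1 * 12) in HN; [|lra].
  replace (C1 * 12 * (c1 / 8 / (C1 * 12))) with (c1 / 8) in HN by (field; lra).
  set (h := A / (t * d)).
  assert (Hh : 0 < h) by (apply Rdiv_lt_0_compat; lra).
  assert (Hhtd : h * (t * d) = A)
    by (unfold h, Rdiv; rewrite Rmult_assoc, Rinv_l by lra; lra).
  assert (Hhd : h <= d / 2)
    by (apply Rmult_le_reg_r with (t * d); [exact Htd|]; unfold N in *; lra).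
  destruct (Rpower_small mu (c1 / 8 * S / Cmod (v p1))) as (s & Hs & Hsm);
    [lra|apply Rdiv_lt_0_compat; nra|].
  assert (Hinv : 0 < / (2 * t * d)) by (apply Rinv_0_lt_compat; lra).
  (* The left endpoint [a] must precede the cut, lose at most one eighth through (a-p1)^mu, and
     satisfy omega (a-p1) <= 1. *)
  assert (Halpha : p1 < p1 + Rmin h (Rmin s (/ (2 * t * d)))).
  { assert (0 < Rmin h (Rmin s (/ (2 * t * d)))); [|lra].
    repeat apply Rmin_glb_lt; assumption. }
  assert (He : 0 < c1 / 8 * S) by nra.
  destruct (is_RInt_gen_approx _ p1 p2 _ (p1 + d / 2) _ _ Halpha ltac:(lra) He Hl)
    as (a & b & Ha & Hb & Happ).
  assert (Hm1 := Rmin_l h (Rmin s (/ (2 * t * d)))).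
  assert (Hm2 := Rmin_r h (Rmin s (/ (2 * t * d)))).
  assert (Hm3 := Rmin_l s (/ (2 * t * d))); assert (Hm4 := Rmin_r s (/ (2 * t * d))).
  specialize (Hsm (a - p1) ltac:(lra)).
  apply Rmult_le_compat_l with (r := Cmod (v p1)) in Hsm; [|lra].
  replace (Cmod (v p1) * (c1 / 8 * S / Cmod (v p1))) with (c1 / 8 * S) in Hsm
    by (field; lra).
  assert (Hhead := wave_head_ge t d h a eta Ht Hd Hh ltac:(lra) ltac:(lra) ltac:(lra)).
  assert (Hau : 2 * t * d * (a - p1) <= 1).
  { apply Rle_trans with (2 * t * d * / (2 * t * d)).
    - apply Rmult_le_compat_l; lra.
    - rewrite Rinv_r by lra; lra. }
  specialize (Hhead Hau ltac:(intros p Hp; apply Heta; lra)).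
  assert (Htail := wave_le_tail_Rpower t d A b Ht Hd ltac:(lra) ltac:(unfold N in *; lra)
    ltac:(lra)).
  fold h C1 S N in Htail.
  set (x := 2 * t * (p1 + d)) in *.
  assert (Hch : RInt (V := CR) (wave p1 mu v t x) a b
    = (RInt (V := CR) (wave p1 mu v t x) a (p1 + h)
      + RInt (V := CR) (wave p1 mu v t x) (p1 + h) b)%C).
  { symmetry; apply (RInt_Chasles (V := CR));
      apply (ex_RInt_wave p1 p2 mu M v dv); try assumption; lra. }
  rewrite Hch in Happ; clear Hch.
  set (J1 := RInt (V := CR) (wave p1 mu v t x) a (p1 + h) : C) in *.
  set (J2 := RInt (V := CR) (wave p1 mu v t x) (p1 + h) b : C) in *.
  assert (Htri := Cmod_triangle_sub J1 (J1 + J2)%C).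
  replace (J1 + J2 - J1)%C with J2 in Htri by ring.
  assert (Htri' := Cmod_triangle_sub (J1 + J2)%C l).
  rewrite <- Cmod_opp, Copp_minus_distr in Happ.
  assert (Hw2 : Rpower (2 * t * d) (- mu) = Rpower 2 (- mu) * S)
    by (unfold S; rewrite Rpower_mult_distr by lra; f_equal; ring).
  assert (HhA : Rpower h mu = Rpower A mu * S).
  { unfold h, S, Rpower; rewrite <- exp_plus; f_equal.
    unfold Rdiv; rewrite (ln_mult A), ln_Rinv by (try apply Rinv_0_lt_compat; lra); ring. }
  assert (Hth2 : t * h ^ 2 = A ^ 2 / N).
  { unfold h, N; field; split; lra. }
  rewrite Hw2, HhA, Hth2 in Hhead.
  assert (Hmain : Cmod (v p1) * ((1 - mu) * (1 - cos 1) * Rpower 2 (mu - 2) * (Rpower 2 (- mu) * S))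
    = c1 * S) by (unfold c1, c0; ring).
  assert (Herr1 : eta / mu * (Rpower A mu * S) = c1 / 8 * S)
    by (unfold eta; field; split; lra).
  assert (Herr2 : Cmod (v p1) * (A ^ 2 / N) / mu * (Rpower A mu * S) <= c1 / 8 * S).
  { replace (Cmod (v p1) * (A ^ 2 / N) / mu * (Rpower A mu * S))
      with (N2 * (c1 / 8) / N * S) by (unfold N2; field; lra).
    apply Rmult_le_compat_r; [lra|].
    apply Rmult_le_reg_r with N; [exact HNpos|].
    replace (N2 * (c1 / 8) / N * N) with (N2 * (c1 / 8)) by (field; lra).
    rewrite (Rmult_comm (c1 / 8)); apply Rmult_le_compat_r; lra. }
  assert (Htail' : Cmod J2 <= c1 / 4 * S).
  { eapply Rle_trans; [exact Htail|].
    replace (C1 * S * (4 * Rpower A (mu - 1) + 12 * Rpower N (mu - / 2)))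
      with ((C1 * 4 * Rpower A (mu - 1) + C1 * 12 * Rpower N (mu - / 2)) * S) by ring.
    apply Rmult_le_compat_r; lra. }
  replace ((eta + Cmod (v p1) * (A ^ 2 / N)) / mu * (Rpower A mu * S))
    with (eta / mu * (Rpower A mu * S) + Cmod (v p1) * (A ^ 2 / N) / mu * (Rpower A mu * S))
    in Hhead by (field; lra).
  rewrite Rmult_minus_distr_l, Hmain in Hhead.
  lra.
Qed.
End Solution.

(** * From the wave integral to the solution, and the theorem *)

Lemma free_solution_wave (p1 p2 mu : R) (v Fu0 : R -> C) (t x : R) (l : C) :
  p1 < p2 ->
  (forall p, p1 < p < p2 -> Fu0 p = singular p1 mu v p) ->
  is_RInt_gen (V := CR) (wave p1 mu v t x) (at_right p1) (at_left p2) l ->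
  free_solution p1 p2 Fu0 t x = (RtoC (/ (2 * PI)) * l)%C.
Proof.
  intros Hp12 HF Hl; unfold free_solution; f_equal.
  apply (is_RInt_gen_unique (V := CR)).
  apply (is_RInt_gen_ext (V := CR) (wave p1 mu v t x)); [|exact Hl].
  apply Filter_prod with (Q := fun u => p1 < u < p2) (R := fun w => p1 < w < p2).
  - now apply at_right_interval.
  - now apply at_left_interval.
  - intros u w Hu Hw p; simpl; intros Hp.
    unfold wave, osc; rewrite HF; [reflexivity|].
    revert Hp; unfold Rmin, Rmax; destruct Rle_dec; lra.
Qed.

Lemma max_exponent_lt (mu delta eps : R) :
  0 < mu < 1 / 2 -> delta < 1 -> 0 < eps < 1 / 2 -> 1 / 2 + eps < delta ->
  MaxRlist (map (fun k : nat => - exponent_sigma delta k + eps * exponent_varsigma mu delta k)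
                (seq 1 9)) < - mu + eps * mu.
Proof.
  intros Hmu Hdelta Heps Hed.
  (* These products certify the nine inequalities. For instance the gap is 2 (1/2-eps) (1/2-mu) for
     k = 1, 2 (1/2-eps) (delta-mu) for k = 5, and 2 (delta-1/2-eps) (1-mu) + 2 (1-delta) (1/2-mu)
     for k = 8. *)
  assert (0 < eps * mu) by nra.
  assert (0 < (1 / 2 - eps) * (1 / 2 - mu)) by nra.
  assert (0 < (delta - 1 / 2 - eps) * (1 - mu)) by nra.
  assert (0 < (1 - delta) * (1 / 2 - mu)) by nra.
  assert (0 < (1 / 2 - eps) * delta) by nra.
  assert (0 < (1 / 2 - eps) * (delta - mu)) by nra.
  unfold exponent_sigma, exponent_varsigma; simpl.
  repeat apply Rmax_lub_lt; nra.
Qed.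

Theorem theorem0p2 :
  forall (mu p1 p2 : R) (u0 : (R -> C) -> C) (Fu0 : R -> C),
    0 < mu < 1 / 2 ->
    p1 < p2 ->
    tempered u0 ->
    Condition_C p1 p2 mu u0 Fu0 ->
  forall delta : R,
    1 / 2 < delta < 1 ->
    (mu + 1) / 2 <= delta ->
  exists K : nat -> R,
    (forall k : nat, (k <= 9)%nat -> 0 <= K k) /\
    forall eps : R,
      0 < eps < 1 / 2 ->
      1 / 2 + eps < delta ->
      (forall t x : R,
         0 < t ->
         2 * p1 + 2 * Rpower t (- eps) <= x / t < 2 * p2 ->
         Rpower (p2 - p1) (- (1 / eps)) < t ->
         Cmod (free_solution p1 p2 Fu0 t x) <=
           K 0%nat * Rpower t (- mu + eps * mu) +
           sum_n_m (fun k : nat =>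
             K k * Rpower t (- exponent_sigma delta k + eps * exponent_varsigma mu delta k)) 1 9) /\
      MaxRlist (map (fun k : nat => - exponent_sigma delta k + eps * exponent_varsigma mu delta k)
                    (seq 1 9)) < - mu + eps * mu /\
      exists c T : R,
        0 < c /\ 0 < T /\
        forall t : R,
          T <= t ->
          c * Rpower t (- mu + eps * mu) <=
          Cmod (free_solution p1 p2 Fu0 t
                  (2 * p1 * t + 2 * Rpower t (1 - eps))).
Proof.
  intros mu p1 p2 u0 Fu0 Hmu Hp12 _ [_ (v & Hv & Hv0 & _ & HF)] delta Hdelta _.
  destruct (C1_segment_amplitude p1 p2 v Hp12 Hv) as [(dv & M & Hamp) Hcont].
  assert (HM := amplitude_pos _ _ _ _ _ Hamp).
  assert (HMm : 0 < M / mu) by (apply Rdiv_lt_0_compat; lra).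
  assert (HL := Rpower_pos (p2 - p1) mu).
  assert (HC1 : 0 < M * (1 + (p2 - p1) / mu)).
  { assert (0 < (p2 - p1) / mu) by (apply Rdiv_lt_0_compat; lra); nra. }
  assert (Hpi : 0 < / (2 * PI)) by (apply Rinv_0_lt_compat; assert (H := PI_RGT_0); lra).
  set (A1 := M / mu * Rpower (p2 - p1) mu).
  assert (HA1 : 0 < A1) by (unfold A1; nra).
  set (A2 := M / mu + 20 * (M * (1 + (p2 - p1) / mu))).
  assert (HA2 : 0 < A2) by (unfold A2; lra).
  assert (Hfree : forall t x, exists l : C,
    is_RInt_gen (V := CR) (wave p1 mu v t x) (at_right p1) (at_left p2) l /\
    Cmod (free_solution p1 p2 Fu0 t x) = / (2 * PI) * Cmod l).
  { intros t x.
    destruct (ex_RInt_gen_wave p1 p2 mu M v dv Hp12 Hmu Hamp t x) as [l Hl].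
    exists l; split; [exact Hl|].
    rewrite (free_solution_wave p1 p2 mu v Fu0 t x l Hp12 HF Hl).
    rewrite Cmod_mult, Cmod_R, Rabs_right by lra; reflexivity. }
  (* The constants are fixed before [eps] is introduced: [A1] serves t < 1 and [A2] serves t >=
     1. *)
  exists (fun k => match k with O => / (2 * PI) * (A1 + A2) | S _ => 0 end).
  split; [intros [|k] _; [nra|lra]|].
  intros eps Heps Hed; split; [|split].
  - intros t x Ht Hx _.
    rewrite (sum_n_m_ext_loc _ (fun _ => zero))
      by (intros [|k] Hk; [lia|apply Rmult_0_l]).
    rewrite sum_n_m_const_zero; unfold zero; simpl; rewrite Rplus_0_r, Rmult_assoc.
    destruct (Hfree t x) as (l & Hl & ->).
    apply Rmult_le_compat_l; [lra|].
    assert (HS := Rpower_pos t (- mu + eps * mu)).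
    destruct (Rle_dec 1 t) as [Ht1|Ht1].
    + set (d := x / (2 * t) - p1).
      assert (Hxt : x / t = 2 * (p1 + d)) by (unfold d; field; lra).
      assert (Hxd : x = 2 * t * (p1 + d)) by (unfold d; field; lra).
      assert (Hd : Rpower t (- eps) <= d) by lra.
      assert (Hd2 : d < p2 - p1) by lra.
      assert (Hd0 := Rpower_pos t (- eps)).
      assert (HtS : Rpower (t * d) (- mu) <= Rpower t (- mu + eps * mu)).
      { replace (Rpower t (- mu + eps * mu)) with (Rpower (t * Rpower t (- eps)) (- mu)).
        - apply Rpower_antitone; [nra|apply Rmult_le_compat_l; lra|lra].
        - rewrite <- Rpower_succ, Rpower_mult by assumption; f_equal; ring. }
      (* Indeed t d^2 >= t^(1 - 2 eps), which is at least 1 for t >= 1 because eps < 1/2. *)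
      assert (HN : 1 <= t * d ^ 2).
      { apply Rle_trans with (t * Rpower t (- eps) ^ 2).
        - simpl; rewrite Rmult_1_r, <- Rmult_assoc, <- Rpower_succ, <- Rpower_plus by assumption.
          rewrite <- (Rpower_O t) at 1 by assumption; apply Rle_Rpower; lra.
        - apply Rmult_le_compat_l; [lra|apply pow_incr; lra]. }
      rewrite Hxd in Hl.
      assert (Hle := solution_le p1 p2 mu M v dv Hp12 Hmu Hamp t d l Ht ltac:(lra) HN Hl).
      fold A2 in Hle.
      assert (A2 * Rpower (t * d) (- mu) <= A2 * Rpower t (- mu + eps * mu))
        by (apply Rmult_le_compat_l; lra).
      nra.
    + assert (Hle := solution_le_trivial p1 p2 mu M v dv Hp12 Hmu Hamp t x l Hl).
      fold A1 in Hle.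
      (* The exponent - mu (1 - eps) is negative and t < 1, so a constant bound is dominated by the
         rate. *)
      assert (1 <= Rpower t (- mu + eps * mu)); [|nra].
      replace 1 with (Rpower 1 (- mu + eps * mu))
        by (unfold Rpower; rewrite ln_1, Rmult_0_r; apply exp_0).
      apply Rpower_antitone; [lra|lra|nra].
  - apply max_exponent_lt; lra.
  - destruct (solution_ge p1 p2 mu M v dv Hp12 Hmu Hamp Hv0 Hcont)
      as (c & N0 & d0 & Hc & HN0 & Hd0 & Hge).
    (* On the left boundary d = t^(-eps). Beyond [T1] one has d <= d0, and beyond [T2] one has t d^2
       = t^(1 - 2 eps) >= N0. *)
    destruct (Rpower_eventually_le (- eps) d0) as (T1 & HT1 & Hsmall); [lra|lra|].
    destruct (Rpower_eventually_le (2 * eps - 1) (/ N0)) as (T2 & HT2 & Hlarge);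
      [lra|apply Rinv_0_lt_compat; lra|].
    exists (/ (2 * PI) * c), (Rmax T1 T2).
    assert (H1 := Rmax_l T1 T2); assert (H2 := Rmax_r T1 T2).
    split; [nra|split; [lra|intros t Ht]].
    assert (Ht0 : 0 < t) by lra.
    specialize (Hsmall t ltac:(lra)); specialize (Hlarge t ltac:(lra)).
    assert (Htd : t * Rpower t (- eps) = Rpower t (1 - eps))
      by (rewrite <- Rpower_succ by assumption; f_equal; ring).
    destruct (Hfree t (2 * p1 * t + 2 * Rpower t (1 - eps))) as (l & Hl & ->).
    rewrite Rmult_assoc; apply Rmult_le_compat_l; [lra|].
    replace (2 * p1 * t + 2 * Rpower t (1 - eps))
      with (2 * t * (p1 + Rpower t (- eps))) in Hl by (rewrite <- Htd; ring).
    replace (Rpower t (- mu + eps * mu)) with (Rpower (t * Rpower t (- eps)) (- mu))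
      by (rewrite Htd, Rpower_mult; f_equal; ring).
    apply Hge; [exact Ht0|split; [apply Rpower_pos|exact Hsmall]| |exact Hl].
    replace (t * Rpower t (- eps) ^ 2) with (/ Rpower t (2 * eps - 1)).
    + rewrite <- (Rinv_inv N0); apply Rinv_le_contravar; [apply Rpower_pos|exact Hlarge].
    + simpl; rewrite Rmult_1_r, <- Rmult_assoc, Htd, <- Rpower_plus, <- Rpower_Ropp.
      f_equal; ring.
Qed.
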